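(* Consider the learning protocol described in the context with stepsize $\Delta(t)=1/t^{1-\epsilon}$ for some $\epsilon\in(0,1)$, run from time $t=1$, and let $Z(t)=\sum_{i=1}^n\|v_i(t)-\mu\|_2^2$. (1) Suppose each of the graphs $G(t)$ is connected, and let $\mathcal{H}$ be the largest hitting time from any node to any node in a very lazy Metropolis walk on any of the graphs $G(t)$. If \[ t \geq 2T \left[ \frac{288T \mathcal{H} }{\epsilon} \ln \left( \frac{96T \mathcal{H} }{\epsilon} \right) \right]^{1/\epsilon}, \] then \[ E[ Z(t) \mid v(1) ] \leq 39\, \mathcal{H} T l\, \frac{M \sigma^2 + n T(\sigma')^2}{(t/T-1)^{1 - \epsilon}} \ln t + Z(1)\, e^{-\frac{(t/T-1)^\epsilon - 2}{24 \mathcal{H} T\epsilon}}. \] (2) In the general case, when each $G(t)$ is not necessarily connected but the sequence $G(t)$ is $B$-connected, if \[ t \geq 2 \max(T,2B) \left[ \frac{384 n^2 d_{\rm max} \left( 1 + \max(T,2B) \right) }{\epsilon} \ln \left( \frac{128 n^2 d_{\rm max} \left( 1 + \max(T,2B) \right) }{\epsilon} \right) \right]^{1/\epsilon}, \] then \[ E[ Z(t) \mid v(1) ] \leq 51 n^{2} d_{\rm max} ( 1 + \max(T,2B))^2\, l\, \frac{ M \sigma^2 + n (\sigma')^2}{\left( t/\max(T,2B) \right)^{1 - \epsilon}} \ln t + Z(1)\, e^{- \frac{\left(t/\max(T,2B) \right)^\epsilon - 2}{32n^2 d_{\rm max} \left( 1 + \max(T,2B) \right) \epsilon}}. \]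
   Context: Model. There are $n\ge 2$ nodes $\{1,\dots,n\}$ and an unknown fixed vector $\mu\in\mathbb{R}^l$. At each time $t$ there is a given (deterministic) undirected graph $G(t)=(\{1,\dots,n\},E(t))$ without self-loops. $N_i(t)$ is the set of neighbors of $i$ in $G(t)$ and $d_i(t)=|N_i(t)|$. The sequence $G(t)$ is called $B$-connected, for a positive integer $B$, if for each integer $k\ge 0$ the graph $(\{1,\dots,n\},\bigcup_{t=kB+1}^{(k+1)B}E(t))$ is connected. At each time $t$ a given (deterministic, possibly empty) set $S(t)\subseteq\{1,\dots,n\}$ of nodes has a measurement $\mu_i(t)=\mu+w_i(t)$, $i\in S(t)$. The measurement times (times $t$ with $S(t)\neq\emptyset$), listed in increasing order as $t_1<t_2<\cdots$, form an infinite sequence with $t_1=1$ and $|t_{k+1}-t_k|<T$ for all $k\ge1$, where $T$ is a positive integer. Each node $i$ keeps an estimate $v_i(t)\in\mathbb{R}^l$ (write $v(t)=(v_1(t),\dots,v_n(t))$), and for each neighbor $j\in N_i(t)$ observes $o_{ij}(t)=v_j(t)-v_i(t)+w_{ij}(t)$. The noises $w_i(t)$, $w_{ij}(t)$ (the latter indexed by ordered pairs) are zero-mean random vectors in $\mathbb{R}^l$, every entry of $w_i(t)$ having variance $\sigma^2$ and every entry of $w_{ij}(t)$ having variance $(\sigma')^2$; all these random vectors are independent of each other, and those at times $t\ge 1$ are independent of $v(1)$. Protocol with stepsizes $\Delta(t)$: if $i\notin S(t)$, \[ v_i(t+1)=v_i(t)+\frac{\Delta(t)}{4}\sum_{j\in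 N_i(t)}\frac{o_{ij}(t)}{\max(d_i(t),d_j(t))}, \] and if $i\in S(t)$, \[ v_i(t+1)=v_i(t)+\frac{\Delta(t)}{4}\left(\mu_i(t)-v_i(t)\right)+\frac{\Delta(t)}{4}\sum_{j\in N_i(t)}\frac{o_{ij}(t)}{\max(d_i(t),d_j(t))}. \] Notation. $d_{\rm max}$ is the largest degree of any node in any graph of the sequence $G(t)$; $M=\max_t|S(t)|$ is the largest number of nodes having a measurement at any one time. The very lazy Metropolis walk on an undirected graph is the random walk which moves from $i$ to a neighbor $j$ with probability $1/(4\max(d(i),d(j)))$, where $d(\cdot)$ denotes degree, and stays put with the remaining probability. The hitting time from $i$ to $j$ is the expected time until the walk started at $i$ visits $j$. *)

(* Defs.v *)
From mathcomp Require Import all_boot all_order all_algebra.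
From mathcomp Require Import all_classical all_reals all_analysis.
From mathcomp Require Import measurable_realfun.

Set Implicit Arguments.
Unset Strict Implicit.
Unset Printing Implicit Defensive.

Import Order.TTheory GRing.Theory Num.Theory.
Import numFieldNormedType.Exports.

Local Open Scope classical_set_scope.
Local Open Scope ring_scope.

(** * Random vectors *)

Definition measurable_vector {R : realType} {d} {Omega : measurableType d}
    {l : nat} (X : Omega -> 'rV[R]_l) : Prop :=
  forall k : 'I_l, measurable_fun [set: Omega] (fun om => X om ord0 k).

(** The sigma-algebra generated by the subfamily [(X i)_(i in D)]. *)
Definition sigma_vectors {R : realType} {Omega I : Type} {l : nat}
    (D : set I) (X : I -> Omega -> 'rV[R]_l) : set (set Omega) :=
  <<s \bigcup_(i in D) \bigcup_(k in [set: 'I_l])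
        preimage_set_system [set: Omega] (fun om => X i om ord0 k)
          (measurable : set (set R)) >>.

(** Mutual independence of [(X i)_(i in D)]. *)
Definition independent_vectors {R : realType} {d} {Omega : measurableType d}
    (P : probability Omega R) {I : eqType} {l : nat}
    (D : set I) (X : I -> Omega -> 'rV[R]_l) : Prop :=
  forall s : seq I, uniq s -> (forall a, a \in s -> D a) ->
  forall E : I -> set Omega,
    (forall a, a \in s -> sigma_vectors [set a] X (E a)) ->
    (P (\bigcap_(a in [set` s]) E a) = \prod_(a <- s) P (E a))%E.

Definition independent_sigma {R : realType} {d} {Omega : measurableType d}
    (P : probability Omega R) (F1 F2 : set (set Omega)) : Prop :=
  forall A B, F1 A -> F2 B -> (P (A `&` B) = P A * P B)%E.

(** [Y] is a version of the conditional expectation [E[X | F]] of the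
    nonnegative, possibly non-integrable, random variable [X]. *)
Definition is_cond_expectation {R : realType} {d} {Omega : measurableType d}
    (P : probability Omega R) (F : set (set Omega)) (X : Omega -> R)
    (Y : Omega -> \bar R) : Prop :=
  (forall C : set (\bar R), measurable C -> F (Y @^-1` C)) /\
  (forall A, F A -> (\int[P]_(om in A) Y om = \int[P]_(om in A) (X om)%:E)%E).

(** * Graphs *)

Definition simple_graph {n : nat} (e : rel 'I_n) : Prop :=
  symmetric e /\ irreflexive e.

Definition neighbors {n : nat} (e : rel 'I_n) (i : 'I_n) : {set 'I_n} :=
  [set j | e i j]%SET.

Definition degree {n : nat} (e : rel 'I_n) (i : 'I_n) : nat :=
  #|neighbors e i|.

Definition graph_connected {n : nat} (e : rel 'I_n) : Prop :=
  forall i j : 'I_n, connect e i j.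

(** The time window is [k * B + 1, ..., (k + 1) * B], both ends included. *)
Definition window_union {n : nat} (G : nat -> rel 'I_n) (B k : nat) :
    rel 'I_n :=
  fun i j => has (fun t => G t i j) (index_iota (k * B).+1 (k.+1 * B).+1).

Definition B_connected {n : nat} (G : nat -> rel 'I_n) (B : nat) : Prop :=
  forall k : nat, graph_connected (window_union G B k).

(** Times start at 1, so index 0 of a sequence is ignored throughout. *)
Definition max_degree (R : realType) {n : nat} (G : nat -> rel 'I_n) : R :=
  sup [set x | exists t i, (1 <= t)%N /\ x = (degree (G t) i)%:R].

(** * Very lazy Metropolis walk *)

Definition metropolis (R : realType) {n : nat} (e : rel 'I_n) (i j : 'I_n) : R :=
  let move k := (4 * (maxn (degree e i) (degree e k))%:R)^-1 in
  if j == i then 1 - \sum_(k in neighbors e i) move k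
  else if j \in neighbors e i then move j else 0.

(** Probability that the chain with transition probabilities [p], started at
    [i], visits [j] for the first time (time 0 included) at time exactly [k]:
    the sum of the probabilities of the trajectories [x 0, ..., x k] with
    [x 0 = i], [x k = j] and no earlier visit to [j]. *)
Definition first_visit {R : realType} {n : nat} (p : 'I_n -> 'I_n -> R)
    (i j : 'I_n) (k : nat) : R :=
  \sum_(x : {ffun 'I_k.+1 -> 'I_n} |
        [&& x ord0 == i, x ord_max == j &
            [forall m : 'I_k, x (widen_ord (leqnSn k) m) != j]])
    \prod_(m < k) p (x (widen_ord (leqnSn k) m)) (x (lift ord0 m)).

(** Expectation of the first visit time, which takes values in the naturals
    extended with infinity; recall that [+oo * 0 = 0]. *)
Definition hitting_time {R : realType} {n : nat} (p : 'I_n -> 'I_n -> R)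
    (i j : 'I_n) : \bar R :=
  (\sum_(0 <= k <oo) (k%:R * first_visit p i j k)%:E
   + +oo * (1 - \sum_(0 <= k <oo) (first_visit p i j k)%:E))%E.

(** On connected graphs the hitting times are finite, so [fine] does not
    truncate there. *)
Definition max_hitting_time (R : realType) {n : nat} (G : nat -> rel 'I_n) : R :=
  fine (ereal_sup [set h : \bar R | exists t i j,
    (1 <= t)%N /\ h = hitting_time (metropolis R (G t)) i j]).

(** * Measurements *)

Definition max_measurements (R : realType) {n : nat} (S : nat -> {set 'I_n}) : R :=
  sup [set x | exists t, (1 <= t)%N /\ x = #|S t|%:R].

(** [tau k] is the (k+1)-st measurement time. *)
Definition measurement_gaps {n : nat} (S : nat -> {set 'I_n}) (T : nat) : Prop :=
  exists tau : nat -> nat,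
    [/\ {homo tau : a b / (a < b)%N},
        forall t, (1 <= t)%N -> (S t != finset.set0 <-> exists k, tau k = t),
        tau 0%N = 1%N
      & forall k, (tau k.+1 - tau k < T)%N].

(** * Noise: [w i t] perturbs the measurement of node [i], [w' i j t] the
      observation by [i] of its neighbor [j]. *)

Notation noise_index n :=
  (('I_n * nat) + ('I_n * 'I_n * nat))%type (only parsing).

Definition noise {R : realType} {Omega : Type} {n l : nat}
    (w : 'I_n -> nat -> Omega -> 'rV[R]_l)
    (w' : 'I_n -> 'I_n -> nat -> Omega -> 'rV[R]_l)
    (a : noise_index n) : Omega -> 'rV[R]_l :=
  match a with
  | inl (i, t) => w i t
  | inr (i, j, t) => w' i j t
  end.

(** Only the noises that enter the protocol are subject to assumptions. *)
Definition active_noise {n : nat} (G : nat -> rel 'I_n)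
    (S : nat -> {set 'I_n}) : set (noise_index n) :=
  fun a => match a with
  | inl (i, t) => (1 <= t)%N /\ i \in S t
  | inr (i, j, t) => (1 <= t)%N /\ j \in neighbors (G t) i
  end.

Definition entries_mean_var {R : realType} {d} {Omega : measurableType d}
    (P : probability Omega R) {l : nat} (X : Omega -> 'rV[R]_l) (s : R) : Prop :=
  forall k : 'I_l, ('E_P[fun om => X om ord0 k] = 0 /\
                    'V_P[fun om => X om ord0 k] = (s ^+ 2)%:E)%E.

Definition noise_assumptions {R : realType} {d} {Omega : measurableType d}
    (P : probability Omega R) {n l : nat} (G : nat -> rel 'I_n)
    (S : nat -> {set 'I_n}) (sigma sigma' : R)
    (v1 : 'I_n -> Omega -> 'rV[R]_l)
    (w : 'I_n -> nat -> Omega -> 'rV[R]_l)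
    (w' : 'I_n -> 'I_n -> nat -> Omega -> 'rV[R]_l) : Prop :=
  [/\ forall i, measurable_vector (v1 i),
      forall a, active_noise G S a -> measurable_vector (noise w w' a),
      (forall i t, (1 <= t)%N -> i \in S t ->
         entries_mean_var P (w i t) sigma) /\
      (forall i j t, (1 <= t)%N -> j \in neighbors (G t) i ->
         entries_mean_var P (w' i j t) sigma'),
      independent_vectors P (active_noise G S) (noise w w')
    & independent_sigma P (sigma_vectors [set: 'I_n] v1)
        (sigma_vectors (active_noise G S) (noise w w'))].

(** * Protocol *)

Definition stepsize {R : realType} (eps : R) (t : nat) : R :=
  (t%:R `^ (1 - eps))^-1.

Definition protocol {R : realType} {Omega : Type} {n l : nat}
    (G : nat -> rel 'I_n) (S : nat -> {set 'I_n}) (mu : 'rV[R]_l)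
    (Delta : nat -> R)
    (w : 'I_n -> nat -> Omega -> 'rV[R]_l)
    (w' : 'I_n -> 'I_n -> nat -> Omega -> 'rV[R]_l)
    (v : nat -> 'I_n -> Omega -> 'rV[R]_l) : Prop :=
  forall (t : nat) (i : 'I_n) (om : Omega), (1 <= t)%N ->
    let o j := v t j om - v t i om + w' i j t om in
    let m := mu + w i t om in
    let consensus := (Delta t / 4) *: \sum_(j in neighbors (G t) i)
      (maxn (degree (G t) i) (degree (G t) j))%:R^-1 *: o j in
    v t.+1 i om =
      if i \in S t then v t i om + (Delta t / 4) *: (m - v t i om) + consensus
      else v t i om + consensus.

Definition norm2 {R : realType} {l : nat} (x : 'rV[R]_l) : R :=
  Num.sqrt (\sum_(k < l) x ord0 k ^+ 2).

Definition deviation {R : realType} {Omega : Type} {n l : nat} (mu : 'rV[R]_l)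
    (v : nat -> 'I_n -> Omega -> 'rV[R]_l) (t : nat) (om : Omega) : R :=
  \sum_(i < n) norm2 (v t i om - mu) ^+ 2.

(* Main.v *)
(* Write [x = v - mu]. In every coordinate [x (t+1) = (1 - Delta/4 A) x t + Delta/4 (noise)],
   where [A] is the weighted Laplacian of [G t] plus the indicator of [S t] on the diagonal.
   Independence makes the noises orthogonal in L2, also on every event of the sigma-algebra
   of [v 1], so the second moment of [x t] is at most its image under the noise-free
   dynamics plus the variances of the noises. It remains to see that the noise-free dynamics
   contracts the square norm on every time window of length [b].
   One step dissipates at least [Delta/4] times the Dirichlet energy [y . A y].
   - Connected graphs ([b = T]): the function [h + 4n], with [h] the hitting time to a measuring
     node, is a supersolution of [A], so Barta's inequality bounds the energy from below by
     [4 / (H + 4n)] times the square norm, and [H >= 4 (n - 1)].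
   - B-connected sequences ([b = max T 2B]): sort the values at the start of the window,
     together with the value 0 of a fictitious measured node. Each gap is crossed by an edge
     or a measurement during the window, and until then no value enters the gap, so the
     window spends at least the sum of the squares of the gaps.
   The resulting scalar recursion is solved by splitting the time interval into two halves:
   the noise of the first half is killed by the contraction over the second half (this is
   where [t] has to be large) and that of the second half sums as a geometric series. *)

(* Nothing is assumed about the moments of [v 1], so the conditional bound is obtained by testing
   [Y] on events of the sigma-algebra of [v 1] on which [Z 1] is bounded: multiplied by the
   indicator of such an event, every error is square integrable.

   In a B-connected sequence no single step need contract, and the contraction of a window belongs
   to the composed flow. Hence the moments [E |Psi X|^2] are followed for matrices [Psi]: the steps
   of the window are absorbed into [Psi] one by one, and the contraction is used once, for the
   complete product. Noise injected on the way is seen through a nonexpansive matrix, so it costs at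
   most its variance.

   The hitting time alone is no positive supersolution, since it vanishes at the target. The shift
   [4n] is forced: summing the equations [A y = 4] with a single sink [k] gives [y k = 4n]. As
   [H + 4n <= 3H], the rate is [1/(3H)] for connected graphs; it is [1/(4 n^2 dmax)] otherwise. With
   the common factor 32 of the scalar recursion these rates produce the constants 96 and 128 of the
   statement. The gap argument, with a window of one step, also shows that hitting times are
   finite. *)
From HB Require Import structures.
Require Import Defs.
From mathcomp Require Import all_boot all_order all_algebra.
From mathcomp Require Import all_classical all_reals all_analysis.
From mathcomp Require Import measurable_realfun.
From mathcomp Require Import ring lra zify.

Set Implicit Arguments.
Unset Strict Implicit.
Unset Printing Implicit Defensive.

Import Order.TTheory GRing.Theory Num.Theory.
Import numFieldNormedType.Exports.

Local Open Scope classical_set_scope.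
Local Open Scope ring_scope.

(* [lia] may diverge when real-valued hypotheses are in the context. *)
Ltac nat_lia := repeat match goal with
  | H : is_true (@Order.le _ _ _ _) |- _ => clear H
  | H : is_true (@Order.lt _ _ _ _) |- _ => clear H
  | H : is_true (_ && _) |- _ => clear H
  | H : forall _, _ |- _ => clear H
  | H : @eq (Real.sort _) _ _ |- _ => clear H
  end; lia.

(** * Square-integrable functions and independence *)

Section square_integrable.
Context d (T : measurableType d) (R : realType) (P : probability T R).
Implicit Types f g : T -> R.

Definition square_integrable f :=
  measurable_fun [set: T] f /\ P.-integrable [set: T] (EFin \o (fun x => f x ^+ 2)).

Lemma square_integrableM f g : square_integrable f -> square_integrable g ->
  P.-integrable [set: T] (EFin \o (fun x => f x * g x)).
Proof.
move=> [mf sf] [mg sg].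
have := integrableD measurableT sf sg.
apply: le_integrable => //.
  by apply/measurable_EFinP; exact: measurable_funM.
move=> x _ /=; rewrite lee_fin [leRHS]ger0_norm ?addr_ge0 ?sqr_ge0//.
by rewrite ler_norml; apply/andP; split; nra.
Qed.

Lemma square_integrable_scale a f : square_integrable f ->
  square_integrable (fun x => a * f x).
Proof.
move=> [mf sf]; split; first exact: measurable_funM.
rewrite (_ : _ \o _ = fun x => ((a ^+ 2)%:E * (f x ^+ 2)%:E)%E).
  exact: integrableZl.
by apply/funext => x /=; rewrite -EFinM exprMn.
Qed.

Lemma square_integrableD f g : square_integrable f -> square_integrable g ->
  square_integrable (fun x => f x + g x).
Proof.
move=> sf sg; have [mf if2] := sf; have [mg ig2] := sg; split.
  exact: measurable_funD.
have ifg := square_integrableM sf sg.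
rewrite (_ : _ \o _ = fun x => ((f x ^+ 2)%:E +
    ((f x * g x)%:E + ((f x * g x)%:E + (g x ^+ 2)%:E)))%E).
  by do !apply: integrableD => //.
by apply/funext => x /=; rewrite -!EFinD; congr EFin; ring.
Qed.

Lemma square_integrable0 : square_integrable (fun=> 0).
Proof.
split; first exact: measurable_cst.
rewrite (_ : _ \o _ = cst 0%:E); first exact: integrable0.
by apply/funext => x /=; rewrite expr0n.
Qed.

Lemma square_integrable_sum (I : Type) (r : seq I) (Q : pred I) (F : I -> T -> R) :
  (forall i, Q i -> square_integrable (F i)) ->
  square_integrable (fun x => \sum_(i <- r | Q i) F i x).
Proof.
move=> sF; elim: r => [|i r ih].
  rewrite (_ : (fun x => _) = fun=> 0); first exact: square_integrable0.
  by apply/funext => x; rewrite big_nil.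
have [Qi|nQi] := boolP (Q i); last first.
  rewrite (_ : (fun x => _) = (fun x => \sum_(j <- r | Q j) F j x)) //.
  by apply/funext => x; rewrite big_cons (negbTE nQi).
rewrite (_ : (fun x => _) = (fun x => F i x + \sum_(j <- r | Q j) F j x)).
  by apply: square_integrableD => //; exact: sF.
by apply/funext => x; rewrite big_cons Qi.
Qed.

Lemma square_integrable_bounded f (K : R) : measurable_fun [set: T] f ->
  (forall x, `|f x| <= K) -> square_integrable f.
Proof.
move=> mf fK; split=> //.
apply: (@le_integrable _ _ _ P _ measurableT _ (cst (K ^+ 2)%:E)).
- by apply/measurable_EFinP; exact: measurable_funX.
- move=> x _ /=; rewrite lee_fin normrX.
  rewrite [leRHS]ger0_norm ?sqr_ge0//.
  have K0 : 0 <= K by apply: le_trans (fK x).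
  by rewrite ler_sqr ?nnegrE.
- exact: finite_measure_integrable_cst.
Qed.

Lemma square_integrable_indic A f : measurable A -> square_integrable f ->
  square_integrable (fun x => \1_A x * f x).
Proof.
move=> mA [mf sf].
have m1f : measurable_fun [set: T] (fun x => \1_A x * f x).
  by apply: measurable_funM => //; exact: (measurable_indic mA).
split => //; apply: (le_integrable measurableT _ _ sf).
  by apply/measurable_EFinP; exact: measurable_funX.
move=> x _ /=; rewrite lee_fin !normrX normrM exprMn indicE.
case: (x \in A) => /=; first by rewrite normr1 expr1n mul1r.
by rewrite normr0 expr0n mul0r sqr_ge0.
Qed.

Lemma square_integrable_integrable f : square_integrable f ->
  P.-integrable [set: T] (EFin \o f).
Proof.
move=> sf.
have s1 : square_integrable (fun=> 1).
  by apply: (@square_integrable_bounded _ 1) => // x; rewrite normr1.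
have := square_integrableM sf s1.
by under [X in _ \o X]eq_fun do rewrite mulr1.
Qed.

Definition inner f g : R := \int[P]_x (f x * g x).

Lemma innerC f g : inner f g = inner g f.
Proof. by apply: eq_Rintegral => x _; rewrite mulrC. Qed.

Lemma innerDl f g h : square_integrable f -> square_integrable g ->
  square_integrable h -> inner (fun x => f x + g x) h = inner f h + inner g h.
Proof.
move=> sf sg sh; rewrite -RintegralD//; try exact: square_integrableM.
by apply: eq_Rintegral => x _; rewrite mulrDl.
Qed.

Lemma innerZl a f g : square_integrable f -> square_integrable g ->
  inner (fun x => a * f x) g = a * inner f g.
Proof.
move=> sf sg; rewrite -RintegralZl//; try exact: square_integrableM.
by apply: eq_Rintegral => x _; rewrite mulrA.
Qed.

Lemma inner_suml (I : Type) (r : seq I) (Q : pred I) (F : I -> T -> R) g :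
  (forall i, Q i -> square_integrable (F i)) -> square_integrable g ->
  inner (fun x => \sum_(i <- r | Q i) F i x) g = \sum_(i <- r | Q i) inner (F i) g.
Proof.
move=> sF sg; elim: r => [|i r ih].
  rewrite big_nil (_ : (fun x => _) = fun=> 0 * 0).
    by rewrite (innerZl _ square_integrable0)// mul0r.
  by apply/funext => x; rewrite big_nil mulr0.
rewrite big_cons -ih; case: ifPn => [Qi|nQi].
  rewrite -innerDl//; [|exact: sF|exact: square_integrable_sum].
  by congr inner; apply/funext => x; rewrite big_cons Qi.
by congr inner; apply/funext => x; rewrite big_cons (negbTE nQi).
Qed.

End square_integrable.

Section independent_product.
Context d (T : measurableType d) (R : realType) (P : probability T R).

(** The joint law agrees with the product of the marginal laws on rectangles, hence everywhere by
    uniqueness of the product measure; Fubini then splits the integral of [z.1 * z.2]. *)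
Lemma Rintegral_independentM (X Y : T -> R) :
  measurable_fun [set: T] X -> measurable_fun [set: T] Y ->
  (forall B C, measurable B -> measurable C ->
    P (X @^-1` B `&` Y @^-1` C) = P (X @^-1` B) * P (Y @^-1` C))%E ->
  P.-integrable [set: T] (EFin \o X) -> P.-integrable [set: T] (EFin \o Y) ->
  P.-integrable [set: T] (EFin \o (fun x => X x * Y x)) ->
  \int[P]_x (X x * Y x) = \int[P]_x X x * \int[P]_x Y x.
Proof.
move=> mX mY ind iX iY iXY.
pose Xm : {mfun T >-> R} := HB.pack X (isMeasurableFun.Build _ _ _ _ _ mX).
pose Ym : {mfun T >-> R} := HB.pack Y (isMeasurableFun.Build _ _ _ _ _ mY).
have mXY : measurable_fun [set: T] (fun x => (X x, Y x)).
  exact: measurable_fun_pair.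
pose XYm : {mfun T >-> (R * R)%type} := HB.pack (fun x => (X x, Y x))
  (isMeasurableFun.Build _ _ _ _ _ mXY).
pose m1 := distribution P Xm; pose m2 := distribution P Ym.
have mprod : measurable_fun [set: R * R] (EFin \o (fun z : R * R => z.1 * z.2)).
  apply/measurable_EFinP; apply: measurable_funM; first exact: measurable_fst.
  exact: measurable_snd.
have E A : measurable A -> (m1 \x m2)%E A = distribution P XYm A.
  by move=> mA; apply: product_measure_unique => // B C; exact: ind.
have iprod : (m1 \x m2)%E.-integrable setT (EFin \o (fun z : R * R => z.1 * z.2)).
  have := @integrable_pushforward _ _ _ _ _ _ mXY P _ _ mprod iXY measurableT.
  move=> /integrableP[_ fin]; apply/integrableP; split => //.
  rewrite (eq_measure_integral (distribution P XYm)) => [|A mA _]; last exact: E.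
  exact: fin.
have EXY : (\int[P]_x (X x * Y x)%:E = \int[m1 \x m2]_z (z.1 * z.2)%:E)%E.
  rewrite [RHS](eq_measure_integral (distribution P XYm)) => [|A mA _]; last exact: E.
  by rewrite (@integral_distribution _ _ _ _ _ P XYm _ mprod iXY).
rewrite /Rintegral EXY -(integral12_prod_meas1 iprod) /fubini_F /=.
have iid : forall U : {mfun T >-> R}, P.-integrable setT (EFin \o U) ->
   (distribution P U).-integrable [set: R] (EFin \o id).
  move=> U iU; apply: integrable_pushforward => //; exact/measurable_EFinP.
have intd : forall U : {mfun T >-> R}, P.-integrable setT (EFin \o U) ->
   (\int[distribution P U]_y y%:E = \int[P]_x (U x)%:E)%E.
  by move=> U iU; rewrite (@integral_distribution _ _ _ _ _ P U _ _ iU).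
under eq_integral => x _.
  under eq_integral => y _ do rewrite EFinM.
  rewrite (integralZl measurableT (iid Ym iY)) /= (intd Ym)//.
  over.
rewrite -(fineK (integrable_fin_num _ iY))//=.
rewrite (integralZr measurableT (iid Xm iX)) /= (intd Xm)//.
rewrite fineM//; exact: integrable_fin_num.
Qed.

End independent_product.

(** * Stepsizes and the scalar recursion *)

Section stepsizes.
Context (R : realType).
Implicit Types (eps x y : R) (a : nat -> R).

(** The tangent bound for the concave power [eps]. It comes from Young's inequality for
    [((x + 1) / x) ^ eps] and 1 with exponents [1 / eps] and [1 / (1 - eps)], which avoids
    derivatives. *)
Lemma powR_succ_le eps x : 0 < eps < 1 -> 0 < x ->
  ((x + 1) `^ eps - x `^ eps) / eps <= (x `^ (1 - eps))^-1.
Proof.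
move=> /andP[e0 e1] x0.
have x1 : 0 <= x + 1 by lra.
have xy0 : 0 <= (x + 1) / x by rewrite divr_ge0// ltW.
have := @conjugate_powR R (((x + 1) / x) `^ eps) 1 eps^-1 (1 - eps)^-1.
rewrite powR_ge0 ler01 !invr_gt0 e0 subr_gt0 e1 !invrK mulr1 powR1 mul1r.
rewrite addrC subrK -powRrM divff ?gt_eqF// powRr1//.
move=> /(_ isT isT isT isT erefl) h.
have xe0 : 0 < x `^ eps by exact: powR_gt0.
have -> : (x + 1) `^ eps = ((x + 1) / x) `^ eps * x `^ eps.
  by rewrite -powRM// ?divfK ?gt_eqF// ltW.
have -> : (x `^ (1 - eps))^-1 = x `^ eps / x.
  by rewrite powRB ?gt_eqF ?implybT// powRr1 ?ltW// invf_div.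
rewrite ler_pdivrMr// -{2}[x `^ eps]mul1r -mulrBl -mulrA mulrC ler_pM2l//.
apply: le_trans (lerB h (lexx 1)) _.
rewrite le_eqVlt; apply/orP; left; apply/eqP.
by field; rewrite gt_eqF.
Qed.

Lemma stepsize_ge0 eps t : 0 <= stepsize eps t.
Proof. by rewrite invr_ge0 powR_ge0. Qed.

Lemma stepsize_gt0 eps t : (0 < t)%N -> 0 < stepsize eps t.
Proof. by move=> t0; rewrite invr_gt0 powR_gt0// ltr0n. Qed.

Lemma stepsize_le eps s t : eps <= 1 -> (0 < s <= t)%N ->
  stepsize eps t <= stepsize eps s.
Proof.
move=> e1 /andP[s0 st]; rewrite lef_pV2 ?posrE ?powR_gt0 ?ltr0n//; last nat_lia.
by rewrite ge0_ler_powR ?nnegrE ?subr_ge0// ler_nat.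
Qed.

Lemma stepsize_le1 eps t : eps <= 1 -> (0 < t)%N -> stepsize eps t <= 1.
Proof.
move=> e1 t0; apply: le_trans (@stepsize_le eps 1 t e1 _) _ => //.
by rewrite /stepsize powR1 invr1.
Qed.

Lemma stepsizeM eps s t :
  stepsize eps (s * t) = stepsize eps s * stepsize eps t.
Proof. by rewrite /stepsize natrM powRM// invfM. Qed.

Lemma stepsize_sum eps m : 0 < eps < 1 ->
  (m.+1%:R `^ eps - 1) / eps <= \sum_(i < m) stepsize eps i.+1.
Proof.
move=> e01; elim: m => [|m ih]; first by rewrite big_ord0 powR1 subrr mul0r.
rewrite big_ord_recr/=; apply: le_trans (lerD ih (powR_succ_le e01 _)).
  rewrite -mulrDl natr1 le_eqVlt; apply/orP; left; apply/eqP; congr (_ / _).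
  by ring.
by rewrite ltr0n.
Qed.

Lemma ln_ge1 x : 4 <= x -> 1 <= ln x.
Proof.
move=> x4; rewrite -(expRK (1 : R)) ler_ln ?posrE ?expR_gt0//; last by apply: lt_le_trans x4.
apply: le_trans x4; have -> : 1 = 2%:R * 2^-1 :> R by rewrite divff.
rewrite expRM_natl.
(* [exp (-1/2) >= 1/2] gives [exp (1/2) <= 2], hence [e <= 4]. *)
have := expR_ge1Dx (- 2^-1 : R); have := expR_gt0 (2^-1 : R); rewrite expRN.
set y := expR _ => y0 hy.
have : y <= 2.
  have : 2^-1 <= y^-1 by lra.
  by rewrite lef_pV2 ?posrE.
nra.
Qed.

Section noisy_contraction.
(** [a] is the second moment, [kappa] the contraction per unit of stepsize, [q] the noise variance
    per step, [m] the number of whole windows before [t] and [h] about half of it. As [stepsize] is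
    multiplicative, [kappaW] says that the window whose last step is at time [j * b] has a factor at
    most [1 - 32 / (W j^(1 - eps))]. *)
Variables (eps : R) (b : nat) (a : nat -> R) (kappa q W : R) (t m h : nat).
Hypotheses (e01 : 0 < eps < 1) (b0 : (0 < b)%N) (q0 : 0 <= q).
Hypotheses (k01 : 0 < kappa <= 1) (a0 : forall s, 0 <= a s).
Hypothesis a_step : forall s k, (0 < s)%N ->
  a (s + k)%N <= a s + k%:R * (stepsize eps s ^+ 2 / 16 * q).
Hypothesis a_window : forall s, (0 < s)%N ->
  a (s + b)%N <= (1 - kappa * stepsize eps (s + b).-1) * a s
                 + b%:R * (stepsize eps s ^+ 2 / 16 * q).
Hypothesis kappaW : 32 / W <= kappa * stepsize eps b.
Hypothesis We4 : 4 <= W / eps.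
Hypothesis t_large :
  2 * b%:R * (3 * (W / eps) * ln (W / eps)) `^ eps^-1 <= t%:R.
Hypotheses (t_mb : (m * b <= t.-1)%N) (t_mb1 : (t <= m.+1 * b)%N).
Hypotheses (mh0 : (2 * h <= m)%N) (mh1 : (m <= (2 * h).+1)%N).

Let e0 : 0 < eps. Proof. by case/andP: e01. Qed.
Let e1 : eps <= 1. Proof. by case/andP: e01 => _ /ltW. Qed.
Let k0 : 0 < kappa. Proof. by case/andP: k01. Qed.
Let b0R : 0 < b%:R :> R. Proof. by rewrite ltr0n. Qed.
Let W0 : 0 < W.
Proof.
have : 0 < W / eps by apply: lt_le_trans We4.
by rewrite pmulr_lgt0// invr_gt0.
Qed.

(** The threshold that [t_large] imposes on [(t / (2 b)) ^ eps]: beyond a multiple of [al * ln al],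
    a number [x] dominates [al * ln x]. *)
Let X0 := 3 * (W / eps) * ln (W / eps).

Let lnW : 1 <= ln (W / eps).
Proof. exact: ln_ge1. Qed.

Let X0_ge : 3 <= X0.
Proof.
rewrite /X0; move: (W / eps) (ln (W / eps)) We4 lnW => x y hx hy; nra.
Qed.

Let X0_pow : X0 <= X0 `^ eps^-1.
Proof.
have X1 : 1 <= X0 by apply: le_trans X0_ge; rewrite ler1n.
rewrite -{1}(powRr1 (le_trans ler01 X1)).
by rewrite ler_powR ?invf_ge1//.
Qed.

Let X0E : X0 = (X0 `^ eps^-1) `^ eps.
Proof.
rewrite -powRrM mulVf ?lt0r_neq0// powRr1//.
by apply: le_trans X0_ge.
Qed.

Let t_div : X0 `^ eps^-1 <= t%:R / b%:R / 2.
Proof.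
rewrite ler_pdivlMr// ler_pdivlMr//; apply: le_trans t_large.
by rewrite -/X0 le_eqVlt; apply/orP; left; apply/eqP; ring.
Qed.

Lemma horizon_ge6 : 6 <= t%:R / b%:R :> R.
Proof.
have := le_trans (le_trans X0_ge X0_pow) t_div.
by rewrite ler_pdivlMr// -natrM.
Qed.

Let t0 : (0 < t)%N.
Proof. by rewrite lt0n; apply/eqP => t0; move: horizon_ge6; rewrite t0 mul0r; lra. Qed.

Let u_m1 : t%:R / b%:R <= m%:R + 1 :> R.
Proof. by rewrite ler_pdivrMr// natr1 -natrM ler_nat. Qed.

Let m_gt2 : (2 < m)%N.
Proof.
have : 2 < m%:R :> R by move: horizon_ge6 u_m1; lra.
by rewrite ltr_nat.
Qed.

Let u_m : t%:R / b%:R <= 2 * m%:R :> R.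
Proof.
have m1 : 1 <= m%:R :> R by rewrite ler1n; move: m_gt2; nat_lia.
by move: u_m1; lra.
Qed.

Let u0 : 0 < t%:R / b%:R :> R.
Proof. by rewrite divr_gt0 ?ltr0n. Qed.

(** Write [ln x = ln (x / al) + ln al] with [al = W / eps]: the first term is below [x / al], the
    second at most a third of it by the choice of [X0]. *)
Let log_bound (x : R) : X0 <= x -> ln x <= 8 * x / (W / eps).
Proof.
rewrite /X0; move: (W / eps) We4 lnW => al al4 lnal hx.
have al0 : 0 < al by apply: lt_le_trans al4.
have x0 : 0 < x by apply: lt_le_trans hx; rewrite !mulr_gt0// (lt_le_trans ltr01).
have z0 : 0 < x / al by rewrite divr_gt0.
have hz : 3 * ln al <= x / al by rewrite ler_pdivlMr// mulrAC.
rewrite -{1}(divfK (lt0r_neq0 al0) x) lnM ?posrE// -mulrA.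
by have := ln_sublinear z0; lra.
Qed.

(** Crude in the noise: steps are at most 1, so each window adds at most [b q / 16] and the total
    grows linearly in [j]. The decay over the second half of the windows can afford this. *)
Lemma noisy_contraction_initial j :
  a (1 + j * b)%N <=
    a 1%N * expR (- (kappa * \sum_(i < j) stepsize eps (i.+1 * b)))
    + j%:R * (b%:R * q / 16).
Proof.
elim: j => [|j ih].
  by rewrite big_ord0 mulr0 oppr0 expR0 mulr1 mul0r addr0 mul0n addn0.
have -> : (1 + j.+1 * b = (1 + j * b) + b)%N by nat_lia.
apply: le_trans (a_window _) _ => //.
have -> : (1 + j * b + b).-1 = (j.+1 * b)%N by nat_lia.
have x1 : stepsize eps (j.+1 * b) <= 1 by apply: stepsize_le1 => //; nat_lia.
have x0 := stepsize_ge0 eps (j.+1 * b).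
have kx : 0 <= 1 - kappa * stepsize eps (j.+1 * b).
  by case/andP: k01 => _ k1; nra.
apply: le_trans (lerD (ler_wpM2l kx ih) (lexx _)) _.
rewrite big_ord_recr/= [kappa * (_ + _)]mulrDr opprD expRD.
set E := expR (- (kappa * _)); set n1 := b%:R * q / 16.
set x := stepsize eps (j.+1 * b) in x1 x0 kx *.
have y1 : stepsize eps (1 + j * b) <= 1 by apply: stepsize_le1.
have y0 := stepsize_ge0 eps (1 + j * b).
have ex : 1 - kappa * x <= expR (- (kappa * x)) by have := expR_ge1Dx (- (kappa * x)).
have E0 : 0 <= E by exact: expR_ge0.
have a1E : 0 <= a 1%N * E by rewrite mulr_ge0.
have n10 : 0 <= n1 by rewrite /n1 divr_ge0 ?mulr_ge0.
have jn : 0 <= j%:R * n1 by rewrite mulr_ge0.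
have h1 : (1 - kappa * x) * (a 1%N * E) <= a 1%N * (E * expR (- (kappa * x))).
  by rewrite mulrA [leRHS]mulrC ler_wpM2r.
have h2 : (1 - kappa * x) * (j%:R * n1) <= j%:R * n1.
  by rewrite ler_piMl// gerBl mulr_ge0// ltW.
have h3 : b%:R * (stepsize eps (1 + j * b) ^+ 2 / 16 * q) <= n1.
  have -> : n1 = b%:R * (16^-1 * q) by rewrite /n1; ring.
  by rewrite ler_wpM2l// ler_wpM2r// ler_piMl// expr_le1.
have -> : j.+1%:R * n1 = j%:R * n1 + n1 by rewrite -natr1; ring.
rewrite addrA; apply: lerD h3; rewrite mulrDr; exact: lerD h1 h2.
Qed.

(** With [th] and [g] uniform over these windows the recursion is [a' <= (1 - th) a + g], whose
    fixed point is [g / th]. *)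
Lemma noisy_contraction_final (g th : R) k :
  0 < th <= 1 ->
  (forall j, (j < k)%N -> th <= kappa * stepsize eps ((h + j).+1 * b)) ->
  b%:R * (stepsize eps (1 + h * b) ^+ 2 / 16 * q) <= g ->
  a (1 + (h + k) * b)%N <= (1 - th) ^+ k * a (1 + h * b)%N + g / th.
Proof.
move=> /andP[th0 th1] hth hg.
have g0 : 0 <= g.
  apply: le_trans hg; rewrite mulr_ge0// mulr_ge0// divr_ge0// sqr_ge0//.
elim: k hth => [_|k ih hth].
  by rewrite addn0 expr0 mul1r lerDl divr_ge0// ltW.
have {}ih := ih (fun j jk => hth j (ltnW jk)).
have -> : (1 + (h + k.+1) * b = (1 + (h + k) * b) + b)%N by nat_lia.
apply: le_trans (a_window _) _ => //.
have -> : (1 + (h + k) * b + b).-1 = ((h + k).+1 * b)%N by nat_lia.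
have hk := hth k (ltnSn k).
have sle : stepsize eps (1 + (h + k) * b) <= stepsize eps (1 + h * b).
  by apply: stepsize_le => //; nat_lia.
have sge := stepsize_ge0 eps (1 + (h + k) * b).
have g1 : b%:R * (stepsize eps (1 + (h + k) * b) ^+ 2 / 16 * q) <= g.
  apply: le_trans hg; rewrite ler_wpM2l// ler_wpM2r// ler_wpM2r//.
  by rewrite ler_sqr ?nnegrE// (le_trans sge).
have ak := a0 (1 + (h + k) * b).
have h1 : (1 - kappa * stepsize eps ((h + k).+1 * b)) * a (1 + (h + k) * b)%N
   <= (1 - th) * a (1 + (h + k) * b)%N.
  by rewrite ler_wpM2r// lerB.
have h2 : (1 - th) * a (1 + (h + k) * b)%N <=
   (1 - th) * ((1 - th) ^+ k * a (1 + h * b)%N + g / th).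
  by rewrite ler_wpM2l// subr_ge0.
apply: le_trans (lerD (le_trans h1 h2) g1) _.
rewrite exprS le_eqVlt; apply/orP; left; apply/eqP.
by field; rewrite gt_eqF.
Qed.

Let m0 : 0 < m%:R :> R. Proof. by rewrite ltr0n; nat_lia. Qed.

(** The right-hand side is a lower bound for the contraction exponent accumulated over the second
    half, so that half multiplies the past by at most [m^-2]. *)
Let me_log : 2 * ln m%:R <= 16 / W * m%:R `^ eps.
Proof.
have X0m : X0 <= m%:R `^ eps.
  rewrite X0E.
  apply: ge0_ler_powR; rewrite ?nnegrE ?powR_ge0 ?ler0n//; first exact: ltW.
  by apply: le_trans t_div _; rewrite ler_pdivrMr// [_ * 2]mulrC.
have := log_bound X0m; rewrite ln_powR.
have W1 : W != 0 by rewrite gt_eqF.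
have e2 : eps != 0 by rewrite gt_eqF.
have -> : 8 * m%:R `^ eps / (W / eps) = eps * (8 / W * m%:R `^ eps).
  by field; rewrite W1 e2.
rewrite ler_pM2l//; lra.
Qed.

Let m_u : (m%:R `^ (1 - eps))^-1 <= 2 * ((t%:R / b%:R) `^ (1 - eps))^-1.
Proof.
rewrite -[leLHS]mul1r ler_pdivrMr ?powR_gt0// mulrAC ler_pdivlMr ?powR_gt0// mul1r.
have p0 : 0 <= 1 - eps by rewrite subr_ge0.
apply: le_trans (_ : (2 * m%:R) `^ (1 - eps) <= _).
  by apply: ge0_ler_powR; rewrite ?nnegrE ?mulr_ge0// ltW.
rewrite powRM// ler_wpM2r ?powR_ge0//.
by apply: ler1_powR; rewrite ?ler1n// lerBlDr lerDl ltW.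
Qed.

Let stepsize_b1 : stepsize eps b <= 1. Proof. exact: stepsize_le1. Qed.

(** The stepsizes of the first half sum to at least [((h + 1)^eps - 1) / eps], with [h + 1 >= u / 2]
    for [u = t / b], and [(u / 2)^eps >= u^eps / 2] because [2^eps <= 2]. *)
Let initial_decay :
  expR (- (kappa * \sum_(i < h) stepsize eps (i.+1 * b)))
  <= expR (- (4 * ((t%:R / b%:R) `^ eps - 2) / (W * eps))).
Proof.
rewrite ler_expR lerN2.
have -> : \sum_(i < h) stepsize eps (i.+1 * b) =
    stepsize eps b * \sum_(i < h) stepsize eps i.+1.
  by rewrite mulr_sumr; apply: eq_bigr => i _; rewrite stepsizeM mulrC.
have hs := @stepsize_sum eps h e01.
have u2 : t%:R / b%:R / 2 <= h.+1%:R :> R.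
  rewrite ler_pdivrMr// (le_trans u_m1)// natr1 -natrM ler_nat.
  by nat_lia.
have u20 : 0 <= t%:R / b%:R / 2 :> R by rewrite divr_ge0// ltW.
have uh : (t%:R / b%:R / 2) `^ eps <= h.+1%:R `^ eps.
  by apply: ge0_ler_powR; rewrite ?nnegrE ?ler0n//; exact: ltW.
have u3 : 3 <= (t%:R / b%:R / 2) `^ eps.
  apply: le_trans X0_ge _.
  rewrite X0E.
  by apply: ge0_ler_powR; rewrite ?nnegrE ?powR_ge0//; exact: ltW.
have u4 : (t%:R / b%:R) `^ eps <= 2 * (t%:R / b%:R / 2) `^ eps.
  rewrite -{1}(divfK (lt0r_neq0 (ltr0n R 2)) (t%:R / b%:R)) powRM// mulrC.
  by rewrite ler_wpM2r ?powR_ge0// ler1_powR// ler1n.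
have u5 : (t%:R / b%:R / 2) `^ eps <= (t%:R / b%:R) `^ eps.
  apply: ge0_ler_powR; rewrite ?nnegrE//; do ?exact: ltW.
  by rewrite ler_pdivrMr// ler_peMr ?ler1n// ltW.
set U := (_ `^ eps) in u4 u5 *; set V := (_ `^ eps) in uh u3 u4 u5.
set S := \sum_(_ < _) _ in hs *.
have VS : (U / 2 - 1) / eps <= S.
  apply: le_trans hs; rewrite ler_pM2r ?invr_gt0//.
  by rewrite lerB// (le_trans _ uh)// ler_pdivrMr// mulrC.
have U2 : 2 <= U by lra.
have W1 : W != 0 by rewrite gt_eqF.
have e2 : eps != 0 by rewrite gt_eqF.
have Ue : 0 <= (U / 2 - 1) / eps by rewrite divr_ge0 ?(ltW e0)//; lra.
rewrite mulrA; apply: le_trans (_ : 32 / W * ((U / 2 - 1) / eps) <= _).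
  have -> : 4 * (U - 2) / (W * eps) = 8 / W * ((U / 2 - 1) / eps).
    by field; rewrite W1 e2.
  by rewrite ler_wpM2r// ler_wpM2r ?invr_ge0 ?(ltW W0)// ler_nat.
rewrite (le_trans (ler_wpM2r Ue kappaW))// ler_wpM2l// mulr_ge0 ?stepsize_ge0//.
exact: ltW.
Qed.

(** Noise is collected in three places: [1/32] from the first half after its decay, [1/16] from the
    steps after the last whole window (together below [1/10]), and [kappa^-1] from the geometric
    series of the second half. The factor 2 replaces [m] by [t / b] in the power. *)
Lemma noisy_contraction_bound :
  a t <= 2 * b%:R * q * (10^-1 + kappa^-1) / (t%:R / b%:R) `^ (1 - eps)
       + a 1%N * expR (- (4 * ((t%:R / b%:R) `^ eps - 2) / (W * eps))).
Proof.
pose mp := (m%:R `^ (1 - eps))^-1 : R.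
have mp0 : 0 < mp by rewrite invr_gt0 powR_gt0.
pose th := kappa * stepsize eps (m * b).
have s0 : 0 < stepsize eps (m * b) by apply: stepsize_gt0; nat_lia.
have s1 : stepsize eps (m * b) <= 1 by apply: stepsize_le1 => //; nat_lia.
have th0 : 0 < th by rewrite mulr_gt0.
have th1 : th <= 1 by case/andP: k01 => _ k1; rewrite /th; nra.
have smp : stepsize eps (m * b) = mp * stepsize eps b by rewrite stepsizeM.
have smle : stepsize eps (m * b) <= mp.
  by rewrite smp ler_piMr// ltW.
have bq0 : 0 <= b%:R * q by rewrite mulr_ge0.
(* [1 + h b >= m b / 4], hence the steps of the second half are at most four times the last one. *)
have hstep : stepsize eps (1 + h * b) <= 4 * stepsize eps (m * b).
  have h4 : (m * b <= 4 * (1 + h * b))%N.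
    have : (m <= 4 * h)%N by have := m_gt2; nat_lia.
    by move=> hh; have := leq_mul2r b m (4 * h); rewrite hh orbT => ?; nat_lia.
  have := @stepsize_le eps (m * b) (4 * (1 + h * b)) e1.
  rewrite h4 andbT => /(_ ltac:(nat_lia)); rewrite stepsizeM => hle.
  have : 4^-1 <= stepsize eps 4.
    rewrite lef_pV2 ?posrE ?powR_gt0//; apply: ler1_powR; first by rewrite ler1n.
    by rewrite gerBl ltW.
  by have := stepsize_ge0 eps (1 + h * b); nra.
(* The square of the 4 in [hstep] cancels the 16 of the noise term. *)
pose g := b%:R * q * stepsize eps (m * b) ^+ 2.
have hg : b%:R * (stepsize eps (1 + h * b) ^+ 2 / 16 * q) <= g.
  rewrite /g -[b%:R * q * _]mulrA ler_wpM2l// [leLHS]mulrC ler_wpM2l//.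
  have : stepsize eps (1 + h * b) ^+ 2 <= (4 * stepsize eps (m * b)) ^+ 2.
    by rewrite ler_sqr ?nnegrE ?stepsize_ge0// mulr_ge0// ltW.
  by rewrite exprMn; lra.
have hm : (h <= m)%N by nat_lia.
have F := @noisy_contraction_final g th (m - h).
rewrite subnKC// in F; have {}F : a (1 + m * b)%N <=
    (1 - th) ^+ (m - h) * a (1 + h * b)%N + g / th.
  apply: F => //.
  - by rewrite th0.
  - move=> j jm; rewrite /th ler_pM2l//; apply: stepsize_le => //.
    by rewrite muln_gt0 b0 /= leq_mul2r; apply/orP; right; nat_lia.
have I := noisy_contraction_initial h.
have L := @a_step (1 + m * b) (t.-1 - m * b) isT.
have tE : (1 + m * b + (t.-1 - m * b) = t)%N by nat_lia.
rewrite tE in L; apply: (le_trans L).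
have gth : g / th <= b%:R * q * kappa^-1 * mp.
  have -> : g / th = b%:R * q * kappa^-1 * stepsize eps (m * b).
    by rewrite /g /th; field; rewrite !gt_eqF.
  by rewrite ler_wpM2l// mulr_ge0// invr_ge0 ltW.
have last_steps : (t.-1 - m * b)%:R * (stepsize eps (1 + m * b) ^+ 2 / 16 * q)
   <= b%:R * q / 16 * mp.
  have s2 : stepsize eps (1 + m * b) <= mp.
    by apply: le_trans smle; apply: stepsize_le => //; nat_lia.
  have s3 : stepsize eps (1 + m * b) <= 1 by apply: stepsize_le1.
  have s4 := stepsize_ge0 eps (1 + m * b).
  have s5 : stepsize eps (1 + m * b) ^+ 2 <= mp by nra.
  have rb : (t.-1 - m * b)%:R <= b%:R :> R by rewrite ler_nat; nat_lia.
  have -> : b%:R * q / 16 * mp = b%:R * (mp / 16 * q) by ring.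
  apply: ler_pM => //; last by rewrite ler_wpM2r// ler_wpM2r.
  by rewrite mulr_ge0// mulr_ge0// sqr_ge0.
pose D := (1 - th) ^+ (m - h).
have D0 : 0 <= D by rewrite exprn_ge0// subr_ge0.
have D1 : D <= 1 by rewrite exprn_ile1 ?subr_ge0// gerBl ltW.
(* The second half contracts by [m^-2], so the [h <= m / 2] noisy windows of the first half leave at
   most [1 / (2 m)], which is below half of [mp]. *)
have Dm : D * h%:R <= 2^-1 * mp.
  have De : D <= expR (- (2 * ln m%:R)).
    apply: le_trans (_ : expR (- th) ^+ (m - h) <= _).
      by rewrite lerXn2r ?nnegrE ?subr_ge0 ?expR_ge0// expR_ge1Dx.
    rewrite -expRM_natl ler_expR mulrN lerN2 (le_trans me_log)//.
    have mh : m%:R / 2 <= (m - h)%:R :> R.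
      by rewrite ler_pdivrMr// -natrM ler_nat; nat_lia.
    apply: le_trans (ler_wpM2r (ltW th0) mh).
    have -> : m%:R / 2 * th = (kappa * stepsize eps b) * m%:R `^ eps / 2.
      have -> : m%:R `^ eps = m%:R * mp.
        have mm : m%:R `^ (1 - eps) * m%:R `^ eps = m%:R :> R.
          by rewrite -powRD ?subrK ?powRr1// (gt_eqF m0) implybT.
        by rewrite -[X in X * mp]mm /mp mulrAC mulfV ?mul1r// gt_eqF// powR_gt0.
      by rewrite /th smp; ring.
    rewrite [leRHS]mulrAC ler_wpM2r ?powR_ge0//.
    by move: kappaW; rewrite -[32]/(16 * 2)%:R natrM; lra.
  have E : expR (- (2 * ln m%:R)) = (m%:R ^+ 2)^-1 :> R.
    by rewrite expRN expRM_natl lnK ?posrE.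
  rewrite E in De.
  have hm2 : h%:R <= m%:R / 2 :> R.
    by rewrite ler_pdivlMr// -natrM ler_nat; nat_lia.
  apply: (le_trans (ler_pM D0 (ler0n _ _) De hm2)).
  have -> : (m%:R ^+ 2)^-1 * (m%:R / 2) = 2^-1 * m%:R^-1 :> R.
    by field; rewrite gt_eqF.
  rewrite ler_pM2l ?invr_gt0// lef_pV2 ?posrE ?powR_gt0//.
  by apply: ler1_powR; rewrite ?ler1n ?gerBl ?(ltW e0)//; nat_lia.
have first_half : D * a (1 + h * b)%N <=
    a 1%N * expR (- (4 * ((t%:R / b%:R) `^ eps - 2) / (W * eps)))
    + b%:R * q / 32 * mp.
  apply: le_trans (ler_wpM2l D0 I) _; rewrite mulrDr lerD//.
    apply: le_trans (ler_wpM2l (a0 1) initial_decay).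
    by rewrite ler_piMl// mulr_ge0// expR_ge0.
  have -> : D * (h%:R * (b%:R * q / 16)) = D * h%:R * (b%:R * q / 16) by ring.
  have -> : b%:R * q / 32 * mp = 2^-1 * mp * (b%:R * q / 16) by field.
  by rewrite ler_wpM2r// divr_ge0.
have tot : b%:R * q / 32 * mp + b%:R * q * kappa^-1 * mp + b%:R * q / 16 * mp
   <= 2 * b%:R * q * (10^-1 + kappa^-1) / (t%:R / b%:R) `^ (1 - eps).
  have -> : b%:R * q / 32 * mp + b%:R * q * kappa^-1 * mp + b%:R * q / 16 * mp
    = b%:R * q * (32^-1 + kappa^-1 + 16^-1) * mp by ring.
  have -> : 2 * b%:R * q * (10^-1 + kappa^-1) / (t%:R / b%:R) `^ (1 - eps) =
    b%:R * q * (10^-1 + kappa^-1) * (2 * ((t%:R / b%:R) `^ (1 - eps))^-1) by ring.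
  have ki : 0 < kappa^-1 by rewrite invr_gt0.
  apply: ler_pM => //; first by rewrite mulr_ge0//; lra.
    by rewrite ltW.
  by rewrite ler_wpM2l//; lra.
rewrite -/D in F; lra.
Qed.

End noisy_contraction.

End stepsizes.

(** * Dirichlet energy *)

Section network_energy.
Context (R : realType) (n : nat).
Implicit Types (e : rel 'I_n) (S : {set 'I_n}) (y : 'cV[R]_n).

Definition sqnorm y : R := \sum_i y i 0 ^+ 2.

Definition weight e (i j : 'I_n) : R :=
  if e i j then (maxn (degree e i) (degree e j))%:R^-1 else 0.

Definition drift e S y (i : 'I_n) : R :=
  \sum_j weight e i j * (y j 0 - y i 0) - (i \in S)%:R * y i 0.

Definition energy e S y : R :=
  2^-1 * (\sum_i \sum_j weight e i j * (y i 0 - y j 0) ^+ 2)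
  + \sum_i (i \in S)%:R * y i 0 ^+ 2.

Definition step_mx e S (D : R) : 'M[R]_n :=
  \matrix_(i, j) ((i == j)%:R * (1 - D / 4 * (\sum_k weight e i k + (i \in S)%:R))
                  + D / 4 * weight e i j).

Lemma step_mxE e S D y i :
  (step_mx e S D *m y) i 0 = y i 0 + D / 4 * drift e S y i.
Proof.
rewrite mxE /drift; under eq_bigr do rewrite mxE mulrDl.
rewrite big_split/= (bigD1 i)//= eqxx mul1r [X in _ + X + _]big1 => [|j ji]; last first.
  by rewrite eq_sym (negbTE ji) !mul0r.
under [X in _ * (X - _)]eq_bigr do rewrite mulrBr.
rewrite big_split/= sumrN -mulr_suml.
have -> : \sum_j D / 4 * weight e i j * y j 0 = D / 4 * \sum_j weight e i j * y j 0.
  by rewrite mulr_sumr; apply: eq_bigr => j _; rewrite mulrA.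
by ring.
Qed.

Lemma weight_ge0 e i j : 0 <= weight e i j.
Proof. by rewrite /weight; case: ifP => // _; rewrite invr_ge0. Qed.

Lemma weightC e i j : symmetric e -> weight e i j = weight e j i.
Proof. by move=> se; rewrite /weight se maxnC. Qed.

Lemma weight_sum_le1 e i : \sum_j weight e i j <= 1.
Proof.
rewrite /weight -big_mkcond/=.
have dE : degree e i = #|[pred j | e i j]|.
  by rewrite /degree /neighbors; apply: eq_card => j; rewrite !inE.
apply: (@le_trans _ _ (\sum_(j | e i j) (degree e i)%:R^-1)).
  apply: ler_sum => j eij.
  have d0 : (0 < degree e i)%N by rewrite dE; apply/card_gt0P; exists j.
  by rewrite lef_pV2 ?posrE ?ltr0n ?ler_nat ?leq_maxl// leq_max d0.
rewrite sumr_const -dE -[leLHS]mulr_natr mulrC.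
have [->|d0] := posnP (degree e i); first by rewrite mul0r.
by rewrite mulfV// pnatr_eq0 -lt0n.
Qed.

(** Jensen's inequality for weights of total mass at most 1. Centring at the weighted sum [m] itself
    still works, since the mass multiplies only [m ^+ 2] in the expansion. *)
Lemma sqr_wsum_le (I : finType) (w z : I -> R) :
  (forall i, 0 <= w i) -> \sum_i w i <= 1 ->
  (\sum_i w i * z i) ^+ 2 <= \sum_i w i * z i ^+ 2.
Proof.
move=> w0 w1; set m := \sum_i w i * z i; have mE : \sum_i w i * z i = m by [].
clearbody m.
have : 0 <= \sum_i w i * (z i - m) ^+ 2.
  by apply: sumr_ge0 => i _; rewrite mulr_ge0// sqr_ge0.
have -> : \sum_i w i * (z i - m) ^+ 2 =
    \sum_i w i * z i ^+ 2 + (m ^+ 2 * (\sum_i w i) - 2 * m * \sum_i w i * z i).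
  rewrite !mulr_sumr -sumrB -big_split/=.
  by apply: eq_bigr => i _; ring.
rewrite mE; have : m ^+ 2 * (\sum_i w i) <= m ^+ 2 by rewrite ler_piMr// sqr_ge0.
by lra.
Qed.

(** Summation by parts: averaging the double sum with its transpose turns [y i * (y j - y i)] into
    minus half a square. *)
Lemma sum_drift e S y : symmetric e ->
  \sum_i y i 0 * drift e S y i = - energy e S y.
Proof.
move=> se; rewrite /drift /energy.
pose F i j := weight e i j * (y i 0 * (y j 0 - y i 0)).
have FE : \sum_i \sum_j F i j =
    - (2^-1 * (\sum_i \sum_j weight e i j * (y i 0 - y j 0) ^+ 2)).
  have h : \sum_i \sum_j F i j = \sum_i \sum_j F j i by rewrite exchange_big.
  have : 2 * (\sum_i \sum_j F i j) = - \sum_i \sum_j weight e i j * (y i 0 - y j 0) ^+ 2.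
    rewrite [2]/(1 + 1) mulrDl mul1r {2}h -big_split/= -sumrN; apply: eq_bigr => i _.
    rewrite -big_split/= -sumrN; apply: eq_bigr => j _.
    by rewrite /F (weightC j i se); ring.
  by lra.
rewrite opprD -FE -sumrN -big_split/=; apply: eq_bigr => i _.
rewrite mulrBr mulr_sumr; congr (_ + _); last by ring.
by apply: eq_bigr => j _; rewrite /F; ring.
Qed.

Lemma energy_ge0 e S y : 0 <= energy e S y.
Proof.
rewrite addr_ge0// ?mulr_ge0//; apply: sumr_ge0 => i _; last by rewrite mulr_ge0 ?sqr_ge0.
by apply: sumr_ge0 => j _; rewrite mulr_ge0 ?weight_ge0 ?sqr_ge0.
Qed.

(** The form of [A^2 <= 4 A] needed here: [(a - b)^2 <= 2 a^2 + 2 b^2] separates neighbors from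
    measurement, and Jensen bounds the neighbor part by the local energy. *)
Lemma sum_sqr_drift_le e S y : \sum_i drift e S y i ^+ 2 <= 4 * energy e S y.
Proof.
have -> : 4 * energy e S y =
  2 * (\sum_i \sum_j weight e i j * (y i 0 - y j 0) ^+ 2) +
  4 * \sum_i (i \in S)%:R * y i 0 ^+ 2.
  by rewrite /energy; lra.
rewrite !mulr_sumr -big_split/=; apply: ler_sum => i _.
rewrite /drift; set a := \sum_j _; set b := _ * y i 0.
have ha : a ^+ 2 <= \sum_j weight e i j * (y i 0 - y j 0) ^+ 2.
  apply: le_trans (sqr_wsum_le _ (weight_ge0 e i) (weight_sum_le1 e i)) _.
  by apply: ler_sum => j _; rewrite -sqrrN opprB.
have hb : b ^+ 2 <= (i \in S)%:R * y i 0 ^+ 2.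
  by rewrite /b; case: (i \in S); rewrite ?mul1r ?mul0r ?expr0n.
have b0 := sqr_ge0 b; have := sqr_ge0 (a + b); nra.
Qed.

(** The linear term gains [D/2] times the energy; the quadratic one costs at most
    [D^2/16 * 4 <= D/4] times it. *)
Lemma sqnorm_step_le e S D y : symmetric e -> 0 <= D <= 1 ->
  sqnorm (step_mx e S D *m y) <= sqnorm y - D / 4 * energy e S y.
Proof.
move=> se /andP[D0 D1].
have -> : sqnorm (step_mx e S D *m y) = sqnorm y +
    (D / 2 * \sum_i y i 0 * drift e S y i + D ^+ 2 / 16 * \sum_i drift e S y i ^+ 2).
  rewrite /sqnorm !mulr_sumr -!big_split/=; apply: eq_bigr => i _.
  by rewrite step_mxE; field.
rewrite sum_drift//; have A0 := energy_ge0 e S y.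
have D16 : 0 <= D ^+ 2 / 16 by rewrite divr_ge0 ?sqr_ge0.
have h1 := ler_wpM2l D16 (sum_sqr_drift_le e S y).
have h2 : D ^+ 2 * energy e S y <= D * energy e S y.
  by rewrite ler_wpM2r// expr2 ler_piMr.
by lra.
Qed.

Lemma sqnorm_ge0 y : 0 <= sqnorm y.
Proof. by apply: sumr_ge0 => i _; exact: sqr_ge0. Qed.

Lemma sqnorm_step_nonexpansive e S D y : symmetric e -> 0 <= D <= 1 ->
  sqnorm (step_mx e S D *m y) <= sqnorm y.
Proof.
move=> se D01; apply: le_trans (sqnorm_step_le S y se D01) _.
by case/andP: D01 => D0 _; rewrite gerBl mulr_ge0 ?energy_ge0// divr_ge0.
Qed.

(* Barta's inequality: a positive supersolution [h] bounds the Dirichlet energy from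
   below, by the identity [(y_i - y_j)^2 - y_i^2 (h_i - h_j)/h_i - y_j^2 (h_j - h_i)/h_j
   = h_i h_j (y_i/h_i - y_j/h_j)^2]. *)
Lemma energy_supersolution e S y (h : 'I_n -> R) (K : R) : symmetric e ->
  (forall i, 0 < h i <= K) ->
  (forall i, 4 <= \sum_j weight e i j * (h i - h j) + (i \in S)%:R * h i) ->
  4 / K * sqnorm y <= energy e S y.
Proof.
move=> se hK h4.
have h0 i : 0 < h i by case/andP: (hK i).
pose F i j := weight e i j * (y i 0 ^+ 2 * (h i - h j) / h i).
have FE : \sum_i \sum_j F i j <=
    2^-1 * (\sum_i \sum_j weight e i j * (y i 0 - y j 0) ^+ 2).
  have hF : \sum_i \sum_j F i j = \sum_i \sum_j F j i by rewrite exchange_big.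
  rewrite mulrC ler_pdivlMr// mulr_natr mulr2n {2}hF -big_split/=.
  apply: ler_sum => i _; rewrite -big_split/=; apply: ler_sum => j _.
  rewrite /F (weightC j i se) -mulrDr ler_wpM2l ?weight_ge0//.
  rewrite -subr_ge0.
  have -> : (y i 0 - y j 0) ^+ 2 - (y i 0 ^+ 2 * (h i - h j) / h i +
     y j 0 ^+ 2 * (h j - h i) / h j) = h i * h j * (y i 0 / h i - y j 0 / h j) ^+ 2.
    by field; rewrite !gt_eqF.
  by rewrite mulr_ge0 ?sqr_ge0// mulr_ge0// ltW.
apply: le_trans (_ : \sum_i \sum_j F i j + \sum_i (i \in S)%:R * y i 0 ^+ 2 <= _);
  last by rewrite lerD2r.
rewrite /sqnorm mulr_sumr -big_split/=; apply: ler_sum => i _.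
have -> : \sum_j F i j + (i \in S)%:R * y i 0 ^+ 2 =
    y i 0 ^+ 2 / h i * (\sum_j weight e i j * (h i - h j) + (i \in S)%:R * h i).
  rewrite mulrDr mulr_sumr; congr (_ + _).
    by apply: eq_bigr => j _; rewrite /F; field; rewrite gt_eqF.
  by field; rewrite gt_eqF.
have yh : 0 <= y i 0 ^+ 2 / h i by rewrite divr_ge0 ?sqr_ge0// ltW.
apply: le_trans (ler_wpM2l yh (h4 i)).
have kh : K^-1 <= (h i)^-1.
  by case/andP: (hK i) => _ hk; rewrite lef_pV2 ?posrE// (lt_le_trans (h0 i)).
by have := ler_wpM2l (sqr_ge0 (y i 0)) kh; lra.
Qed.

End network_energy.

(** * B-connected windows *)

Section gap_argument.
Context (R : realType) (n : nat).
Implicit Types (e : rel 'I_n) (S U : {set 'I_n}) (y z : 'cV[R]_n) (f : 'I_n -> R).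

(** With no edge out of [U] and no measurement in [U], the new value is a convex combination of
    values in [U]. *)
Lemma step_mx_ge e S (D L : R) U y i : 0 <= D <= 1 ->
  (forall i j, i \in U -> j \notin U -> ~~ e i j) -> (forall i, i \in U -> i \notin S) ->
  (forall j, j \in U -> L <= y j 0) -> i \in U -> L <= (step_mx e S D *m y) i 0.
Proof.
move=> /andP[D0 D1] eU SU hy iU.
rewrite step_mxE /drift (negbTE (SU _ iU)) mul0r subr0.
have w1 := @weight_sum_le1 R n e i; have yi := hy i iU.
have : (\sum_j weight R e i j) * (L - y i 0) <= \sum_j weight R e i j * (y j 0 - y i 0).
  rewrite mulr_suml; apply: ler_sum => j _.
  have [jU|jU] := boolP (j \in U); first by rewrite ler_wpM2l ?weight_ge0// lerB// hy.
  by rewrite /weight (negbTE (eU _ _ iU jU)) !mul0r.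
have w0 : 0 <= \sum_j weight R e i j by apply: sumr_ge0 => j _; exact: weight_ge0.
set w := \sum_j _ in w0 w1 *; set g := \sum_j _ => hg.
have h1 : D / 4 * (w * (L - y i 0)) <= D / 4 * g by rewrite ler_wpM2l// divr_ge0.
have h2 : 0 <= (1 - D / 4 * w) * (y i 0 - L).
  by rewrite mulr_ge0 ?subr_ge0//; nra.
by nra.
Qed.

(** Outside [U] measurements are allowed: they pull towards 0, and [0 <= L]. *)
Lemma step_mx_le e S (D L : R) U y i : 0 <= D <= 1 -> 0 <= L ->
  (forall i j, i \notin U -> j \in U -> ~~ e i j) ->
  (forall j, j \notin U -> y j 0 <= L) -> i \notin U -> (step_mx e S D *m y) i 0 <= L.
Proof.
move=> /andP[D0 D1] L0 eU hy iU.
rewrite step_mxE /drift.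
have w1 := @weight_sum_le1 R n e i; have yi := hy i iU.
have : \sum_j weight R e i j * (y j 0 - y i 0) <= (\sum_j weight R e i j) * (L - y i 0).
  rewrite mulr_suml; apply: ler_sum => j _.
  have [jU|jU] := boolP (j \in U); last by rewrite ler_wpM2l ?weight_ge0// lerB// hy.
  by rewrite /weight (negbTE (eU _ _ iU jU)) !mul0r.
have w0 : 0 <= \sum_j weight R e i j by apply: sumr_ge0 => j _; exact: weight_ge0.
have : - ((i \in S)%:R * y i 0) <= (i \in S)%:R * (L - y i 0).
  by case: (i \in S); rewrite ?mul1r ?mul0r ?oppr0//; lra.
have : 0 <= ((i \in S)%:R : R) <= 1 by rewrite ler0n lern1 leq_b1.
move: (i \in S)%:R => s s01.
set w := \sum_j _ in w0 w1 *; set g := \sum_j _ => hs hg.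
have h1 : D / 4 * (g - s * y i 0) <= D / 4 * ((w + s) * (L - y i 0)).
  by rewrite ler_wpM2l ?divr_ge0//; lra.
have h2 : 0 <= (1 - D / 4 * (w + s)) * (L - y i 0).
  by rewrite mulr_ge0 ?subr_ge0//; nra.
by lra.
Qed.

(** Unit conductances, so that a single edge across a gap already costs the full square of the gap.
    Returning to [energy] costs a factor [dmax]. *)
Definition unweighted_energy e S f : R :=
  2^-1 * (\sum_i \sum_j (e i j)%:R * (f i - f j) ^+ 2)
  + \sum_i (i \in S)%:R * f i ^+ 2.

Lemma unweighted_energy_ge0 e S f : 0 <= unweighted_energy e S f.
Proof.
rewrite addr_ge0// ?mulr_ge0//; apply: sumr_ge0 => i _; last by rewrite mulr_ge0 ?sqr_ge0.
by apply: sumr_ge0 => j _; rewrite mulr_ge0 ?sqr_ge0.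
Qed.

Lemma unweighted_energy_edge e S f i j : symmetric e -> e i j -> i != j ->
  (f i - f j) ^+ 2 <= unweighted_energy e S f.
Proof.
move=> se eij ij; rewrite -[leLHS]addr0; apply: lerD; last first.
  by apply: sumr_ge0 => k _; rewrite mulr_ge0 ?sqr_ge0.
have F0 k m : 0 <= (e k m)%:R * (f k - f m) ^+ 2 by rewrite mulr_ge0 ?sqr_ge0.
have S0 k : 0 <= \sum_m (e k m)%:R * (f k - f m) ^+ 2 by apply: sumr_ge0.
have Sij k m : (e k m)%:R * (f k - f m) ^+ 2 <= \sum_m (e k m)%:R * (f k - f m) ^+ 2.
  by rewrite (bigD1 m)//= lerDl sumr_ge0.
rewrite (bigD1 i)//= [X in _ * (_ + X)](bigD1 j) 1?eq_sym//=.
have := Sij i j; have := Sij j i; rewrite se eij !mul1r -[f j - f i]opprB sqrrN.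
have : 0 <= \sum_(k < n | (k != i) && (k != j)) \sum_m (e k m)%:R * (f k - f m) ^+ 2.
  by apply: sumr_ge0.
by lra.
Qed.

Lemma unweighted_energy_sink e S f i : i \in S ->
  f i ^+ 2 <= unweighted_energy e S f.
Proof.
move=> iS; rewrite -[leLHS]add0r; apply: lerD.
  rewrite mulr_ge0//; apply: sumr_ge0 => k _; apply: sumr_ge0 => j _.
  by rewrite mulr_ge0 ?sqr_ge0.
rewrite (bigD1 i)//= iS mul1r lerDl; apply: sumr_ge0 => k _.
by rewrite mulr_ge0 ?sqr_ge0.
Qed.

Lemma unweighted_energy_le e S y (dmax : R) : 1 <= dmax ->
  (forall i, (degree e i)%:R <= dmax) ->
  unweighted_energy e S (fun i => y i 0) <= dmax * energy e S y.
Proof.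
move=> d1 hd; have d0 : 0 < dmax by apply: lt_le_trans d1.
rewrite /unweighted_energy /energy mulrDr; apply: lerD; last first.
  rewrite mulr_sumr; apply: ler_sum => i _.
  by rewrite ler_peMl// mulr_ge0 ?sqr_ge0.
rewrite mulrCA ler_wpM2l// mulr_sumr; apply: ler_sum => i _.
rewrite mulr_sumr; apply: ler_sum => j _.
rewrite [leRHS]mulrA ler_wpM2r ?sqr_ge0// /weight; case: ifP => [eij|_]; last by rewrite mulr0.
have h : (0 < maxn (degree e i) (degree e j))%N.
  rewrite leq_max; apply/orP; left; apply/card_gt0P; exists j.
  by rewrite /neighbors inE.
rewrite ler_pdivlMr ?ltr0n// mul1r.
by rewrite /maxn; case: ifP => _; exact: hd.
Qed.

Lemma sum_sqr_le_sqr_sum (m : nat) (a : nat -> R) : (forall k, (k < m)%N -> 0 <= a k) ->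
  0 <= \sum_(k < m) a k /\ \sum_(k < m) a k ^+ 2 <= (\sum_(k < m) a k) ^+ 2.
Proof.
elim: m => [|m ih] ha; first by rewrite !big_ord0 expr0n.
have [h0 h] := ih (fun k km => ha k (ltnW km)).
rewrite !big_ord_recr/=; have am := ha m (ltnSn m).
by split; [rewrite addr_ge0|nra].
Qed.

Section clamps.
Variables (m : nat) (th : nat -> R).
Hypotheses (th0 : th 0%N = 0) (thS : forall k, (k < m)%N -> th k <= th k.+1).

(** The part of the positive part of [x] that lies in the layer between [th k] and [th k.+1].
    Slicing into layers lets each gap be charged to an energy of its own. *)
Definition clamp (k : nat) (x : R) : R :=
  Num.min (Num.max 0 x) (th k.+1) - Num.min (Num.max 0 x) (th k).

Lemma th_ge0 k : (k <= m)%N -> 0 <= th k.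
Proof.
elim: k => [|k ih] km; first by rewrite th0.
by apply: le_trans (thS km); apply: ih; exact: ltnW.
Qed.

Lemma clamp_homo k x x' : (k < m)%N -> x' <= x -> clamp k x' <= clamp k x.
Proof.
move=> km xx; have {}xx : Num.max 0 x' <= Num.max 0 x by rewrite ge_max !le_max xx lexx orbT.
move: xx (thS km); rewrite /clamp; move: (Num.max 0 x) (Num.max 0 x') => u u'.
by rewrite !minEle; do ![case: ifPn; rewrite -?ltNge => ?] => *; lra.
Qed.

(** The layer increments all have the sign of [x - x'] and telescope to the increment of a
    1-Lipschitz truncation; for terms of one sign, the sum of squares is at most the square of the
    sum. *)
Lemma clamp_sqr_sum x x' : \sum_(k < m) (clamp k x - clamp k x') ^+ 2 <= (x - x') ^+ 2.
Proof.
wlog xx : x x' / x' <= x => [hw|].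
  have [|/ltW xx] := leP x' x; first exact: hw.
  rewrite -[leRHS]sqrrN opprB; apply: le_trans (hw _ _ xx).
  by apply: ler_sum => k _; rewrite -[leLHS]sqrrN opprB.
have [h0 h] := @sum_sqr_le_sqr_sum m (fun k => clamp k x - clamp k x')
  (fun k km => ltac:(by rewrite subr_ge0 clamp_homo)).
apply: (le_trans h); rewrite ler_sqr ?nnegrE ?subr_ge0//.
have tele (z : R) : \sum_(k < m) clamp k z = Num.min (Num.max 0 z) (th m).
  rewrite -(big_mkord xpredT (clamp^~ z)) telescope_sumr// th0.
  by rewrite [X in _ - X](_ : _ = 0) ?subr0//; apply/min_idPr; rewrite le_max lexx.
have hmax : 0 <= Num.max 0 x - Num.max 0 x' <= x - x'.
  by rewrite !maxEle; do ![case: ifPn; rewrite -?ltNge => ?]; lra.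
move: hmax; rewrite sumrB !tele; move: (Num.max 0 x) (Num.max 0 x') => u u'.
by rewrite !minEle; do ![case: ifPn; rewrite -?ltNge => ?] => *; lra.
Qed.

Lemma clamp_above k x : (k < m)%N -> th k.+1 <= x -> clamp k x = th k.+1 - th k.
Proof.
move=> km hx; have hM : th k.+1 <= Num.max 0 x by rewrite le_max hx orbT.
rewrite /clamp (min_idPr hM); congr (_ - _); apply/min_idPr.
exact: le_trans (thS km) hM.
Qed.

Lemma clamp_below k x : (k < m)%N -> x <= th k -> clamp k x = 0.
Proof.
move=> km hx; have hM : Num.max 0 x <= th k by rewrite ge_max hx th_ge0// ltnW.
by rewrite /clamp (min_idPl hM) (min_idPl (le_trans hM (thS km))) subrr.
Qed.

(** This prevents double counting: one edge may cross many gaps at the same time, yet the costs of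
    all layers together fit into the true energy. The measurement term compares with the value 0,
    where every layer vanishes. *)
Lemma unweighted_energy_clamp e S f :
  \sum_(k < m) unweighted_energy e S (fun i => clamp k (f i)) <= unweighted_energy e S f.
Proof.
rewrite /unweighted_energy big_split/= -mulr_sumr; apply: lerD.
  rewrite ler_wpM2l// exchange_big; apply: ler_sum => i _/=.
  rewrite exchange_big; apply: ler_sum => j _/=.
  by rewrite -mulr_sumr ler_wpM2l// clamp_sqr_sum.
rewrite exchange_big; apply: ler_sum => i _/=.
rewrite -mulr_sumr ler_wpM2l//.
have := clamp_sqr_sum (f i) 0; rewrite subr0; apply: le_trans.
apply: ler_sum => k _; rewrite [X in _ - X](@clamp_below k 0) ?subr0//.
exact/th_ge0/ltnW.
Qed.

End clamps.

(** The sorted positive parts, preceded by the value 0 of the fictitious node: [n + 1] levels and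
    [n] gaps, with no value strictly inside a gap. *)
Lemma exists_thresholds (z : 'I_n -> R) : exists th : nat -> R,
  [/\ th 0%N = 0, forall k, (k < n)%N -> th k <= th k.+1,
      forall k i, (k < n)%N -> Num.max 0 (z i) <= th k \/ th k.+1 <= Num.max 0 (z i),
      forall k, (k < n)%N -> exists i, th k.+1 = Num.max 0 (z i)
    & forall i, Num.max 0 (z i) <= th n].
Proof.
pose s := sort <=%R [seq Num.max 0 (z i) | i <- enum 'I_n].
have ss : size s = n by rewrite size_sort size_map size_enum_ord.
have srt : sorted <=%R s by apply: sort_sorted; exact: le_total.
have s0 : all (fun x => 0 <= x) s.
  by rewrite all_sort; apply/allP => x /mapP[i _ ->]; rewrite le_max lexx.
pose th k := nth 0 (0 :: s) k.
have srt0 : sorted <=%R (0 :: s).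
  by rewrite /= path_min_sorted.
have mono j k : (j <= k)%N -> (k <= n)%N -> th j <= th k.
  move=> jk kn; apply: (sorted_leq_nth le_trans le_refl 0 srt0) => //; rewrite inE/= ss.
    by rewrite ltnS (leq_trans jk).
  by rewrite ltnS.
have idx i : exists2 j, (j < n)%N & th j.+1 = Num.max 0 (z i).
  have zs : Num.max 0 (z i) \in s.
    by rewrite mem_sort; apply/mapP; exists i => //; rewrite mem_enum.
  exists (index (Num.max 0 (z i)) s); first by rewrite -ss index_mem.
  by rewrite /th/= nth_index.
exists th; split => //.
- by move=> k kn; exact: mono.
- move=> k i kn; have [j jn <-] := idx i.
  have [kj|jk] := leqP k j; [right|left]; first by apply: mono.
  by apply: mono => //; exact: ltnW.
- move=> k kn; have : th k.+1 \in s by rewrite /th/= mem_nth ?ss.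
  by rewrite mem_sort => /mapP[i _ ->]; exists i.
- by move=> i; have [j jn <-] := idx i; apply: mono.
Qed.

Fixpoint flow_mx (e : nat -> rel 'I_n) (S : nat -> {set 'I_n}) (D : nat -> R) (k : nat)
    : 'M[R]_n :=
  if k is k'.+1 then step_mx (e k') (S k') (D k') *m flow_mx e S D k' else 1%:M.

Section window.
Variables (e : nat -> rel 'I_n) (S : nat -> {set 'I_n}) (D : nat -> R).
Hypotheses (eg : forall k, simple_graph (e k)) (D01 : forall k, 0 <= D k <= 1).

(** A measurement in [U] counts as an edge to the fictitious node, which lies outside every [U]. *)
Definition crosses U k :=
  [exists i in U, [exists j, (j \notin U) && e k i j]] || [exists i in U, i \in S k].

Variables (b : nat) (dmax : R).
Hypothesis hU : forall U, U != finset.set0 -> exists2 k, (k < b)%N & crosses U k.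

(* Up to the first time an edge or a sink crosses the cut at the gap
   [th k, th k.+1], no value enters the gap, so the crossing spends at least its square. *)
Lemma gap_crossing (z : 'cV[R]_n) (th : nat -> R) (m k : nat) : (k < m)%N ->
  th 0%N = 0 -> (forall k, (k < m)%N -> th k <= th k.+1) ->
  (forall i, Num.max 0 (z i 0) <= th k \/ th k.+1 <= Num.max 0 (z i 0)) ->
  (exists i, th k.+1 = Num.max 0 (z i 0)) ->
  (th k.+1 - th k) ^+ 2 <=
    \sum_(t < b) unweighted_energy (e t) (S t)
       (fun i => clamp th k ((flow_mx e S D t *m z) i 0)).
Proof.
move=> km th0 thS hz [i0 hi0].
have sum0 : 0 <= \sum_(t < b) unweighted_energy (e t) (S t)
     (fun i => clamp th k ((flow_mx e S D t *m z) i 0)).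
  by apply: sumr_ge0 => t _; exact: unweighted_energy_ge0.
have := thS _ km; rewrite le_eqVlt => /predU1P[<-|gap].
  by rewrite subrr expr0n.
have thk0 := th_ge0 th0 thS (ltnW km).
pose U : {set 'I_n} := [set i | th k.+1 <= z i 0]%SET.
have inU i : i \notin U -> z i 0 <= th k.
  rewrite inE -ltNge => zi; have [|] := hz i; first by rewrite ge_max => /andP[].
  by rewrite le_max; lra.
have U0 : U != finset.set0.
  (* The level [th k.+1] is strictly positive here, so at [i0] the positive part is the value
     itself. *)
  apply/set0Pn; exists i0; rewrite inE.
  by move: hi0; rewrite maxEle; case: ifP => _ h; lra.
have exk : exists k, (k < b)%N && crosses U k.
  by have [t tb ct] := hU U0; exists t; rewrite tb.
case: (ex_minnP exk) => t /andP[tb ct] tmin.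
have inv s : (s <= t)%N ->
    (forall i, i \in U -> th k.+1 <= (flow_mx e S D s *m z) i 0) /\
    (forall i, i \notin U -> (flow_mx e S D s *m z) i 0 <= th k).
  elim: s => [|s ih] st.
    by rewrite mul1mx; split => i; [rewrite inE|exact: inU].
  have [ih1 ih2] := ih (ltnW st).
  have nc : ~~ crosses U s.
    apply/negP => c; have := tmin s; rewrite c andbT (ltn_trans st tb) => /(_ isT).
    by rewrite leqNgt st.
  move: nc; rewrite negb_or => /andP[nc1 nc2].
  have nS i : i \in U -> i \notin S s.
    by move=> iU; apply: contra nc2 => iS; apply/exists_inP; exists i.
  have nE i j : i \in U -> j \notin U -> ~~ e s i j.
    move=> iU jU; apply: contra nc1 => eij; apply/exists_inP; exists i => //.
    by apply/existsP; exists j; rewrite jU.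
  split=> i iU; rewrite /= -mulmxA.
    by apply: step_mx_ge iU.
  apply: (@step_mx_le _ _ _ _ U) => //.
  by move=> i' j' iU' jU'; have [-> _] := eg s; exact: nE.
have [i1 i2] := inv t (leqnn t).
apply: le_trans (_ : unweighted_energy (e t) (S t)
       (fun i => clamp th k ((flow_mx e S D t *m z) i 0)) <= _); last first.
  rewrite (bigD1 (Ordinal tb))//= lerDl; apply: sumr_ge0 => t' _.
  exact: unweighted_energy_ge0.
case/orP: ct => [/exists_inP[i iU /existsP[j /andP[jU eij]]]|/exists_inP[i iU iS]].
  have ij : i != j by apply: contraNneq jU => <-.
  have := @unweighted_energy_edge (e t) (S t)
    (fun i => clamp th k ((flow_mx e S D t *m z) i 0)) i j (eg t).1 eij ij.
  rewrite /= (@clamp_above m th)//; last exact: i1.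
  by rewrite (@clamp_below m th)//; [rewrite subr0|exact: i2].
have := @unweighted_energy_sink (e t) (S t)
    (fun i => clamp th k ((flow_mx e S D t *m z) i 0)) i iS.
by rewrite /= (@clamp_above m th)//; exact: i1.
Qed.

Hypotheses (n0 : (0 < n)%N) (d1 : 1 <= dmax).
Hypothesis hd : forall k i, (k < b)%N -> (degree (e k) i)%:R <= dmax.

(** A nonnegative entry is at most the top level, which is the sum of the [n] gaps. Cauchy-Schwarz
    costs the factor [n], and each squared gap is paid by its own layer during the window. *)
Lemma window_energy_pos z i : 0 <= z i 0 ->
  z i 0 ^+ 2 <= n%:R * (dmax * \sum_(t < b) energy (e t) (S t) (flow_mx e S D t *m z)).
Proof.
move=> zi0.
have [th [th0 thS hz1 hz2 hz3]] := exists_thresholds (fun i => z i 0).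
have n0R : 0 < n%:R :> R by rewrite ltr0n.
have sumth : \sum_(k < n) (th k.+1 - th k) = th n.
  by rewrite -(big_mkord xpredT (fun k => th k.+1 - th k)) telescope_sumr// th0 subr0.
have h1 : th n ^+ 2 <= n%:R * \sum_(k < n) (th k.+1 - th k) ^+ 2.
  have := @sqr_wsum_le R _ (fun=> n%:R^-1) (fun k : 'I_n => th k.+1 - th k).
  have -> : \sum_(k < n) n%:R^-1 = 1 :> R.
    by rewrite sumr_const card_ord -[LHS]mulr_natr mulVf// gt_eqF.
  rewrite -!mulr_sumr sumth.
  move=> /(_ (fun=> ltac:(by rewrite invr_ge0)) (lexx _)).
  by rewrite exprMn expr2 -mulrA ler_pM2l ?invr_gt0// ler_pdivrMl.
apply: le_trans (le_trans _ h1) _.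
  rewrite ler_sqr ?nnegrE// ?(th_ge0 th0 thS)//.
  by apply: le_trans (hz3 i); rewrite le_max lexx orbT.
rewrite ler_pM2l// mulr_sumr.
apply: le_trans (_ : \sum_(k < n) \sum_(t < b) unweighted_energy (e t) (S t)
       (fun i => clamp th k ((flow_mx e S D t *m z) i 0)) <= _).
  apply: ler_sum => k _; apply: (@gap_crossing z th n k) => //.
  - by move=> j; exact: hz1.
  - exact: hz2.
rewrite exchange_big/=; apply: ler_sum => t _.
apply: le_trans (unweighted_energy_clamp th0 thS _ _ (fun i => (flow_mx e S D t *m z) i 0)) _.
by apply: unweighted_energy_le => // j; exact: hd.
Qed.

(** Negative entries are handled by [- z], since the energy is even and the flow linear; summing
    over the entries gives the second factor [n]. *)
Lemma window_energy z :
  sqnorm z <= n%:R ^+ 2 * dmax * \sum_(t < b) energy (e t) (S t) (flow_mx e S D t *m z).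
Proof.
set E := \sum_(t < b) _.
have key i : z i 0 ^+ 2 <= n%:R * (dmax * E).
  have [zi|/ltW zi] := leP 0 (z i 0); first exact: window_energy_pos.
  have EN : E = \sum_(t < b) energy (e t) (S t) (flow_mx e S D t *m (- z)).
    apply: eq_bigr => t _; rewrite mulmxN /energy; congr (_ * _ + _).
      apply: eq_bigr => k _; apply: eq_bigr => j _.
      by rewrite !mxE -opprD sqrrN.
    by apply: eq_bigr => k _; rewrite !mxE sqrrN.
  have := @window_energy_pos (- z) i; rewrite -EN mxE sqrrN; apply.
  by rewrite oppr_ge0.
apply: le_trans (ler_sum _ (fun i _ => key i)) _.
rewrite sumr_const card_ord -[leLHS]mulr_natr.
by rewrite le_eqVlt; apply/orP; left; apply/eqP; ring.
Qed.

Lemma flow_sqnorm_decrease z k : sqnorm (flow_mx e S D k *m z) <=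
  sqnorm z - \sum_(t < k) D t / 4 * energy (e t) (S t) (flow_mx e S D t *m z).
Proof.
elim: k => [|k ih]; first by rewrite big_ord0 mul1mx subr0.
rewrite big_ord_recr/= -mulmxA.
apply: le_trans (sqnorm_step_le _ _ (eg k).1 (D01 k)) _.
by rewrite opprD addrA lerB.
Qed.

Lemma flow_sqnorm_antitone z j k : (j <= k)%N ->
  sqnorm (flow_mx e S D k *m z) <= sqnorm (flow_mx e S D j *m z).
Proof.
move=> /subnK <-; elim: (k - j)%N => [//|m ih]; rewrite addSn /= -mulmxA.
exact: le_trans (sqnorm_step_nonexpansive _ _ (eg _).1 (D01 _)) ih.
Qed.

Lemma flow_nonexpansive z k : sqnorm (flow_mx e S D k *m z) <= sqnorm z.
Proof. by rewrite -[in leRHS](mul1mx z); exact: (@flow_sqnorm_antitone z 0). Qed.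

(** One dissipative step suffices: the steps before and after it do not increase the norm. *)
Lemma flow_contraction_at (kappa : R) z k m : (k < m)%N ->
  4 * kappa * sqnorm (flow_mx e S D k *m z)
    <= energy (e k) (S k) (flow_mx e S D k *m z) -> 0 <= 1 - kappa * D k ->
  sqnorm (flow_mx e S D m *m z) <= (1 - kappa * D k) * sqnorm z.
Proof.
move=> km hE k1; apply: le_trans (flow_sqnorm_antitone z km) _.
rewrite /= -mulmxA; apply: le_trans (sqnorm_step_le _ _ (eg k).1 (D01 k)) _.
apply: le_trans (ler_wpM2l k1 (flow_nonexpansive z k)).
have /andP[D0 _] := D01 k.
have := ler_wpM2l D0 hE; lra.
Qed.

Lemma window_contraction (Dmin : R) z : 0 <= Dmin ->
  (forall k, (k < b)%N -> Dmin <= D k) ->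
  sqnorm (flow_mx e S D b *m z) <= (1 - (4 * n%:R ^+ 2 * dmax)^-1 * Dmin) * sqnorm z.
Proof.
move=> Dm0 hD; apply: le_trans (flow_sqnorm_decrease z b) _.
rewrite mulrBl mul1r lerB//.
have dn : 0 < 4 * n%:R ^+ 2 * dmax.
  by rewrite !mulr_gt0// ?exprn_gt0 ?ltr0n// (lt_le_trans ltr01).
apply: le_trans (_ : Dmin / 4 * \sum_(t < b) energy (e t) (S t) (flow_mx e S D t *m z) <= _).
  rewrite -[leLHS]mulrA ler_pdivrMl//.
  have := ler_wpM2l Dm0 (window_energy z); lra.
rewrite mulr_sumr; apply: ler_sum => t _; rewrite ler_wpM2r ?energy_ge0//.
by rewrite ler_wpM2r// hD.
Qed.

End window.
End gap_argument.

(** * Hitting times *)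

Section cuts.
Context (n : nat).
Implicit Types (e : rel 'I_n) (U : {set 'I_n}).

Lemma connect_cut e U i j : connect e i j -> i \in U -> j \notin U ->
  exists i' j', [/\ i' \in U, j' \notin U & e i' j'].
Proof.
move=> /connectP[p]; elim: p i => [|a p ih] i /=.
  by move=> _ -> iU; rewrite iU.
move=> /andP[eia pa] jE; have [aU|aU] := boolP (a \in U).
  by move=> _; exact: (ih a pa jE aU).
by move=> iU _; exists i, a.
Qed.

End cuts.

(** * The walk killed at a target, and its relation to the hitting time *)

Section killed_walk.
Context (R : realType) (n : nat).
Variables (e : rel 'I_n) (k : 'I_n).
Hypotheses (n2 : (2 <= n)%N) (eg : simple_graph e) (ec : graph_connected e).

Let se : symmetric e := eg.1.
Let S1 : {set 'I_n} := [set k]%SET.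

(** A Poincare inequality, read off from the gap argument for a window of one step, where the flow
    is the identity; the third factor [n] bounds the degree. It serves for invertibility and for
    finite hitting times. *)
Lemma killed_energy (z : 'cV[R]_n) : sqnorm z <= n%:R ^+ 3 * energy e S1 z.
Proof.
have D01 (m : nat) : 0 <= (0 : R) <= 1 by rewrite lexx ler01.
have cut U : U != finset.set0 -> exists2 m, (m < 1)%N & crosses (fun=> e) (fun=> S1) U m.
  move=> /set0Pn[i iU]; exists 0%N => //; apply/orP.
  have [kU|kU] := boolP (k \in U).
    by right; apply/exists_inP; exists k => //; rewrite inE.
  have [i' [j' [iU' jU' eij]]] := connect_cut (ec i k) iU kU.
  by left; apply/exists_inP; exists i' => //; apply/existsP; exists j'; rewrite jU'.
have n0 : (0 < n)%N by exact: ltnW.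
have n1 : 1 <= n%:R :> R by rewrite ler1n.
have dn (m : nat) i : (m < 1)%N -> (degree e i)%:R <= n%:R :> R.
  by move=> _; rewrite ler_nat -[leqRHS](card_ord n) max_card.
have := window_energy (fun=> eg) D01 cut n0 n1 dn z.
by rewrite big_ord1 /= mul1mx -exprSr.
Qed.

(** [y] is the mean lifetime of the walk [1 - A/4], which dies with probability [1/4] at each step
    from [k]. The matrix is invertible because a kernel vector has zero energy. *)
Lemma exists_killed_solution : exists y : 'cV[R]_n, forall i, - drift e S1 y i = 4.
Proof.
(* The value 4 makes the factor [D / 4] equal to 1; it is not a stepsize. *)
pose A := 1%:M - step_mx e S1 (4 : R).
have AE y i : (A *m y) i 0 = - drift e S1 y i.
  by rewrite mulmxBl mul1mx mxE [X in _ + X]mxE step_mxE; field.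
have Au : A \in unitmx.
  rewrite unitmxE unitfE -det_tr; apply/negP => /det0P[v v0 vA].
  have Av : A *m v^T = 0 by rewrite -[A]trmxK -trmx_mul vA trmx0.
  have E0 : energy e S1 v^T = 0.
    rewrite -[LHS]opprK -sum_drift// big1 ?oppr0// => i _.
    by have := AE v^T i; rewrite Av mxE => /eqP; rewrite eq_sym oppr_eq0 => /eqP ->; rewrite mulr0.
  have := killed_energy v^T; rewrite E0 mulr0 => sq0.
  have {}sq0 : \sum_i (v^T i 0) ^+ 2 = 0 by apply/eqP; rewrite eq_le sq0 sqnorm_ge0.
  case/negP: v0; apply/eqP/rowP => i; rewrite [RHS]mxE.
  have := psumr_eq0P (fun i _ => sqr_ge0 (v^T i 0)) sq0 (i := i) isT.
  by move/eqP; rewrite sqrf_eq0 mxE => /eqP.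
exists (invmx A *m const_mx 4) => i.
by rewrite -AE mulmxA mulmxV// mul1mx mxE.
Qed.

Variable y : 'cV[R]_n.
Hypothesis yE : forall i, - drift e S1 y i = 4.

(** In the sum of all [n] equations the edge terms cancel by symmetry and only the sink term
    survives. *)
Lemma killed_solution_sink : y k 0 = 4 * n%:R.
Proof.
have sum0 : \sum_i \sum_j weight R e i j * (y j 0 - y i 0) = 0.
  set T := LHS; suff : T = - T by lra.
  rewrite {1}/T exchange_big -sumrN; apply: eq_bigr => i _ /=.
  rewrite -sumrN; apply: eq_bigr => j _.
  by rewrite (weightC R j i se); ring.
have : \sum_i - drift e S1 y i = 4 * n%:R.
  by rewrite (eq_bigr _ (fun i _ => yE i)) sumr_const card_ord -[LHS]mulr_natr.
move=> <-; rewrite sumrN sumrB sum0 sub0r opprK.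
rewrite (bigD1 k)//= inE eqxx mul1r big1 ?addr0// => i ik.
by rewrite inE (negbTE ik) mul0r.
Qed.

(** A lifetime is the time to reach [k] plus the lifetime from [k]; subtracting the latter leaves
    the hitting time of [k]. *)
Definition killed_time i : R := y i 0 - 4 * n%:R.

Lemma killed_time_target : killed_time k = 0.
Proof. by rewrite /killed_time killed_solution_sink subrr. Qed.

Lemma killed_timeE i : i != k ->
  \sum_j weight R e i j * (killed_time i - killed_time j) = 4.
Proof.
move=> ik; rewrite -(yE i) /drift inE (negbTE ik) mul0r subr0 -sumrN.
by apply: eq_bigr => j _; rewrite /killed_time; ring.
Qed.

(** Minimum principle: at a minimum other than [k] the left side of [killed_timeE] would be
    nonpositive instead of 4. *)
Lemma killed_time_ge0 i : 0 <= killed_time i.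
Proof.
have [i0 _ imin] := @Order.TotalTheory.arg_minP _ _ _ k xpredT killed_time isT.
apply: le_trans (imin i isT).
have [->|ik] := eqVneq i0 k; first by rewrite killed_time_target.
have := killed_timeE ik.
have : \sum_j weight R e i0 j * (killed_time i0 - killed_time j) <= 0.
  apply: sumr_le0 => j _; rewrite mulr_ge0_le0 ?weight_ge0// subr_le0.
  exact: imin.
by lra.
Qed.

Lemma killed_solution_gt0 i : 0 < y i 0.
Proof.
have := killed_time_ge0 i; rewrite /killed_time.
have : 0 < n%:R :> R by rewrite ltr0n; lia.
by lra.
Qed.

(** The energy of [y] is 4 times its sum [s], while Cauchy-Schwarz and [killed_energy] bound [s^2]
    by [n^4] times that energy; dividing by [s] gives a crude but finite bound. *)
Lemma killed_time_le i : killed_time i <= 4 * n%:R ^+ 4.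
Proof.
have n0 : 0 < n%:R :> R by rewrite ltr0n; lia.
set s := \sum_i y i 0.
have y0 j : 0 <= y j 0 by exact/ltW/killed_solution_gt0.
have ys : y i 0 <= s.
  by rewrite /s (bigD1 i)//= lerDl; apply: sumr_ge0.
have s0 : 0 < s by apply: lt_le_trans ys; exact: killed_solution_gt0.
have E4 : energy e S1 y = 4 * s.
  rewrite -[LHS]opprK -sum_drift// -sumrN mulr_sumr; apply: eq_bigr => j _.
  by rewrite -mulrN yE mulrC.
have s2 : s ^+ 2 <= n%:R * sqnorm y.
  have := @sqr_wsum_le R _ (fun=> n%:R^-1) (fun j => y j 0).
  have -> : \sum_(j < n) n%:R^-1 = 1 :> R.
    by rewrite sumr_const card_ord -[LHS]mulr_natr mulVf// gt_eqF.
  rewrite -!mulr_sumr => /(_ (fun=> ltac:(by rewrite invr_ge0)) (lexx _)).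
  by rewrite exprMn expr2 -mulrA ler_pM2l ?invr_gt0// ler_pdivrMl.
have := killed_energy y; rewrite E4 => h.
have : s ^+ 2 <= n%:R * (n%:R ^+ 3 * (4 * s)) by apply: le_trans s2 _; rewrite ler_pM2l.
have -> : n%:R * (n%:R ^+ 3 * (4 * s)) = (4 * n%:R ^+ 4) * s by ring.
rewrite expr2 ler_pM2r// => sn.
by rewrite /killed_time (le_trans _ (le_trans ys sn))// gerBl mulr_ge0.
Qed.

(** The equation at [k] makes the weighted sum of the times of its neighbors equal to [4 (n - 1)],
    with weights of total at most 1. *)
Lemma killed_time_max_ge : exists i, 4 * (n%:R - 1) <= killed_time i.
Proof.
have [i0 _ imax] := @Order.TotalTheory.arg_maxP _ _ _ k xpredT killed_time isT.
exists i0.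
have : \sum_j weight R e k j * killed_time j = 4 * (n%:R - 1).
  have := yE k; rewrite /drift inE eqxx mul1r killed_solution_sink.
  rewrite (eq_bigr (fun j => weight R e k j * killed_time j)); last first.
    by move=> j _; rewrite /killed_time -killed_solution_sink.
  by lra.
move=> <-; apply: le_trans (_ : \sum_j weight R e k j * killed_time i0 <= _).
  by apply: ler_sum => j _; rewrite ler_wpM2l ?weight_ge0//; exact: imax.
rewrite -mulr_suml ler_piMl ?killed_time_ge0//; exact: weight_sum_le1.
Qed.

Lemma metropolis_ge0 i j : 0 <= metropolis R e i j.
Proof.
rewrite /metropolis; case: ifP => [_|_]; last by case: ifP => // _; rewrite invr_ge0.
rewrite subr_ge0; apply: le_trans (_ : \sum_j weight R e i j <= 1); last exact: weight_sum_le1.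
rewrite /weight -big_mkcond/=.
under eq_bigl do rewrite inE.
apply: ler_sum => m _; rewrite invfM ler_piMl ?invr_ge0// invf_le1//.
by rewrite ler1n.
Qed.

Lemma metropolis_sum (f : 'I_n -> R) i :
  \sum_j metropolis R e i j * f j = f i - 4^-1 * \sum_j weight R e i j * (f i - f j).
Proof.
rewrite (bigD1 i)//= /metropolis eqxx.
have -> : \sum_(j in neighbors e i) (4 * (maxn (degree e i) (degree e j))%:R)^-1 =
    4^-1 * \sum_j weight R e i j.
  rewrite mulr_sumr big_mkcond/=; apply: eq_bigr => j _.
  by rewrite inE /weight; case: ifP => _; rewrite ?mulr0// invfM.
have -> : \sum_(j < n | j != i) (if j == i then 1 - 4^-1 * \sum_j weight R e i j
       else if j \in neighbors e i then (4 * (maxn (degree e i) (degree e j))%:R)^-1 else 0) * f j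
    = 4^-1 * \sum_j weight R e i j * f j.
  rewrite [RHS]mulr_sumr [RHS](bigD1 i)//=.
  rewrite [X in _ = X + _](_ : _ = 0) ?add0r; last first.
    by rewrite /weight (eg.2 i) mul0r mulr0.
  apply: eq_bigr => j ji; rewrite (negbTE ji) inE [in RHS]/weight; case: ifP => _; last by rewrite !mul0r mulr0.
  by rewrite invfM mulrA.
have -> : \sum_j weight R e i j * (f i - f j) =
    (\sum_j weight R e i j) * f i - \sum_j weight R e i j * f j.
  by rewrite mulr_suml -sumrB; apply: eq_bigr => j _; rewrite mulrBr.
by ring.
Qed.

End killed_walk.

(** The partial-sum form of the tail formula for an expectation, with [f] the law and [s] the tail;
    the truncation subtracts [s m] from every term. *)
Lemma summation_by_parts (R : comNzRingType) (f s : nat -> R) (m : nat) :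
  (forall l, f l.+1 = s l - s l.+1) ->
  \sum_(0 <= l < m.+1) l%:R * f l = \sum_(0 <= l < m) (s l - s m).
Proof.
move=> fs; elim: m => [|m ih]; first by rewrite big_nat1 big_geq// mul0r.
rewrite big_nat_recr//= ih fs [RHS]big_nat_recr//= !big_split/= !sumr_const_nat !subn0.
ring.
Qed.

(** For nonnegative terms the lower bound is needed only along some partial sums; [N] chooses them,
    and an explicit rate [c / (m + 1)] replaces a limit argument. *)
Lemma nneseries_EFin_eq (R : realType) (u : nat -> R) (a c : R) (N : nat -> nat) :
  (forall m, 0 <= u m) -> (forall m, \sum_(0 <= l < m) u l <= a) ->
  (forall m, a - c / m.+1%:R <= \sum_(0 <= l < (N m).+1) u l) ->
  (\sum_(0 <= l <oo) (u l)%:E = a%:E)%E.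
Proof.
move=> u0 ua uN; apply/eqP; rewrite eq_le; apply/andP; split.
  apply: lime_le; first by apply: is_cvg_nneseries => l _; rewrite lee_fin.
  by apply: nearW => m; rewrite sumEFin lee_fin.
apply/lee_addgt0Pr => /= x x0.
pose m := Num.truncn (c / x).
apply: le_trans (_ : ((\sum_(0 <= l < (N m).+1) u l) + x)%:E <= _)%E.
  rewrite lee_fin -lerBlDr; apply: le_trans (uN m); rewrite lerB//.
  by rewrite ler_pdivrMr ?ltr0n// mulrC -ler_pdivrMr// ltW// truncnS_gt.
rewrite EFinD -sumEFin leeD2r//; apply: nneseries_lim_ge => l _.
by rewrite lee_fin.
Qed.

(** * First-step equations identify the hitting time *)

Section first_visit_theory.
Context (R : realType) (n : nat) (p : 'I_n -> 'I_n -> R).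

Lemma first_visit_start i j : first_visit p i j 0 = (i == j)%:R.
Proof.
rewrite /first_visit big_mkcond/=.
have only x : [forall m : 'I_0, x (widen_ord (leqnSn 0) m) != j] by apply/forallP => -[].
have -> : ord_max = ord0 :> 'I_1 by apply/val_inj.
have [->|ij] := eqVneq i j; last first.
  apply: big1 => x _; case: ifP => // /and3P[/eqP xi /eqP xj _].
  by move: ij; rewrite -xi -xj eqxx.
rewrite (bigD1 [ffun=> j])//= ffunE eqxx only/= big_ord0 big1 ?addr0// => x xj.
case: ifP => // /and3P[/eqP x0 _ _]; case/negP: xj; apply/eqP/ffunP => m.
by rewrite ffunE -x0; congr (x _); apply/val_inj; case: m => -[].
Qed.

Lemma first_visit_targetS j m : first_visit p j j m.+1 = 0.
Proof.
apply: big1 => x /and3P[/eqP x0 _ /forallP/(_ ord0)].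
by rewrite (_ : widen_ord _ _ = ord0) ?x0 ?eqxx//; apply/val_inj.
Qed.

Let cons_ffun m (ay : 'I_n * {ffun 'I_m.+1 -> 'I_n}) : {ffun 'I_m.+2 -> 'I_n} :=
  [ffun i => oapp ay.2 ay.1 (unlift ord0 i)].

Let cons_ffun_bij m : bijective (@cons_ffun m).
Proof.
exists (fun x : {ffun 'I_m.+2 -> 'I_n} => (x ord0, [ffun i => x (lift ord0 i)])) => [[a y]|x].
  congr (_, _); first by rewrite ffunE unlift_none.
  by apply/ffunP => i; rewrite !ffunE liftK.
apply/ffunP => i; rewrite ffunE; case: unliftP => [i' ->|->] //=.
by rewrite ffunE.
Qed.

(** First-step decomposition: a trajectory is its starting point followed by a shorter trajectory,
    through the bijection [cons_ffun]. *)
Lemma first_visitS i j m : i != j ->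
  first_visit p i j m.+1 = \sum_a p i a * first_visit p a j m.
Proof.
move=> ij; rewrite /first_visit big_mkcond (reindex _ (onW_bij _ (cons_ffun_bij m))) /=.
rewrite -(pair_bigA _ (fun a y => let x := cons_ffun (a, y) in
  if [&& x ord0 == i, x ord_max == j &
            [forall k : 'I_m.+1, x (widen_ord (leqnSn m.+1) k) != j]]
  then \prod_(k < m.+1) p (x (widen_ord (leqnSn m.+1) k)) (x (lift ord0 k)) else 0)) /=.
rewrite (bigD1 i)//= [X in _ + X]big1 ?addr0 => [|a ai]; last first.
  by apply: big1 => y _; rewrite ffunE unlift_none /= (negbTE ai).
under [RHS]eq_bigr do rewrite mulr_sumr big_mkcond/=.
rewrite exchange_big/=; apply: eq_bigr => y _.
rewrite (bigD1 (y ord0))//= eqxx [X in _ = _ + X]big1 ?addr0 => [|a ay]; last first.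
  by rewrite eq_sym (negbTE ay).
have x0 : cons_ffun (i, y) ord0 = i by rewrite ffunE unlift_none.
have xS k : cons_ffun (i, y) (lift ord0 k) = y k by rewrite ffunE liftK.
have w0 : widen_ord (leqnSn m.+1) ord0 = ord0 by apply/val_inj.
have wS (k : 'I_m) : widen_ord (leqnSn m.+1) (lift ord0 k) =
    lift ord0 (widen_ord (leqnSn m) k) by apply/val_inj.
have -> : ord_max = lift ord0 ord_max :> 'I_m.+2 by apply/val_inj.
rewrite x0 eqxx xS /=; congr (if _ && _ then _ else _).
  apply/forallP/forallP => h k.
    by have := h (lift ord0 k); rewrite wS xS.
  case: (unliftP ord0 k) => [k' ->|->]; first by rewrite wS xS.
  by rewrite w0 x0.
rewrite big_ord_recl w0 x0 xS; congr (_ * _); apply: eq_bigr => k _.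
by rewrite wS !xS.
Qed.

Hypothesis p_ge0 : forall i j, 0 <= p i j.

Lemma first_visit_ge0 i j m : 0 <= first_visit p i j m.
Proof. by apply: sumr_ge0 => x _; apply: prodr_ge0 => k _. Qed.

Hypothesis p_sum : forall i, \sum_j p i j = 1.
Variables (j : 'I_n) (h : 'I_n -> R) (K : R).
Hypotheses (h0 : forall i, 0 <= h i) (hK : forall i, h i <= K) (hj : h j = 0).
Hypothesis hE : forall i, i != j -> h i = 1 + \sum_a p i a * h a.

(** The probability that [j] is not visited up to and including time [m]. *)
Let surv m i : R := 1 - \sum_(0 <= l < m.+1) first_visit p i j l.

Let surv0 i : surv 0 i = (i != j)%:R.
Proof.
rewrite /surv big_nat1 first_visit_start.
by case: (i == j) => /=; rewrite ?subrr ?subr0.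
Qed.

Let surv_target m : surv m j = 0.
Proof.
rewrite /surv big_nat_recl// first_visit_start eqxx big1_seq ?addr0 ?subrr// => l _.
exact: first_visit_targetS.
Qed.

Let survS m i : i != j -> surv m.+1 i = \sum_a p i a * surv m a.
Proof.
move=> ij; rewrite /surv big_nat_recl// first_visit_start (negbTE ij) add0r.
under eq_bigr do rewrite first_visitS//.
rewrite exchange_big/= -[in LHS](p_sum i) -sumrB; apply: eq_bigr => a _.
by rewrite mulrBr mulr1 mulr_sumr.
Qed.

Let surv_ge0 m i : 0 <= surv m i.
Proof.
elim: m i => [|m ih] i; first by rewrite surv0.
have [->|ij] := eqVneq i j; first by rewrite surv_target.
by rewrite survS//; apply: sumr_ge0 => a _; rewrite mulr_ge0.
Qed.

Let surv_le m m' i : (m <= m')%N -> surv m' i <= surv m i.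
Proof.
move=> mm; rewrite /surv lerB// (@big_cat_nat _ _ _ m.+1 0 m'.+1)//=.
by rewrite lerDl; apply: sumr_ge0 => l _; exact: first_visit_ge0.
Qed.

(** The part of the candidate [h] not yet accounted for by the tail formula after [m] terms. *)
Let rest m i : R := h i - \sum_(0 <= l < m) surv l i.

Let rest_target m : rest m j = 0.
Proof. by rewrite /rest hj big1_seq ?subr0// => l _; exact: surv_target. Qed.

Let restS m i : i != j -> rest m.+1 i = \sum_a p i a * rest m a.
Proof.
move=> ij; rewrite /rest big_nat_recl// surv0 ij hE//.
under eq_bigr do rewrite survS//.
rewrite exchange_big/= opprD addrACA subrr add0r -sumrB; apply: eq_bigr => a _.
by rewrite mulrBr mulr_sumr.
Qed.

(** Away from [j] both [rest] and [surv] evolve by the same positive operator, so the comparison at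
    time 0, which is [0 <= h <= K], propagates. *)
Let rest_bounds m i : 0 <= rest m i <= K * surv m i.
Proof.
elim: m i => [|m ih] i.
  rewrite /rest big_geq// subr0 h0 surv0; have [->|ij] := eqVneq i j; first by rewrite /= hj mulr0 lexx.
  by rewrite /= mulr1 hK.
have [->|ij] := eqVneq i j; first by rewrite rest_target surv_target mulr0 lexx.
rewrite restS// survS// mulr_sumr; apply/andP; split.
  by apply: sumr_ge0 => a _; rewrite mulr_ge0//; case/andP: (ih a).
apply: ler_sum => a _; rewrite mulrCA ler_wpM2l//; by case/andP: (ih a).
Qed.

Let K0 : 0 <= K. Proof. exact: le_trans (h0 j) (hK j). Qed.

Let surv_sum_le m i : \sum_(0 <= l < m) surv l i <= h i.
Proof. by have /andP[+ _] := rest_bounds m i; rewrite subr_ge0. Qed.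

(** Markov's inequality: the tail is decreasing and its sums stay below [h]. *)
Let surv_decay m i : m.+1%:R * surv m i <= K.
Proof.
apply: le_trans (hK i); apply: le_trans (surv_sum_le m.+1 i).
apply: le_trans (_ : \sum_(0 <= l < m.+1) surv m i <= _).
  by rewrite sumr_const_nat subn0 -[leRHS]mulr_natl.
by rewrite !big_mkord; apply: ler_sum => l _; apply: surv_le; rewrite -ltnS.
Qed.

Let mean_partial m i : \sum_(0 <= l < m.+1) l%:R * first_visit p i j l =
  \sum_(0 <= l < m) (surv l i - surv m i).
Proof.
apply: (@summation_by_parts R (first_visit p i j) (surv^~ i)) => l.
by rewrite /surv [in X in _ = _ - X]big_nat_recr//=; ring.
Qed.

Let mean_partial_le m i : \sum_(0 <= l < m) l%:R * first_visit p i j l <= h i.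
Proof.
case: m => [|m]; first by rewrite big_geq.
rewrite mean_partial; apply: le_trans (surv_sum_le m i).
by apply: ler_sum => l _; rewrite gerBl.
Qed.

(** The tail decays only like [K / m], so the boundary term, [m + 1] copies of a tail, is made small
    by evaluating that tail at the square of [m + 1]. *)
Let mean_partial_ge m i :
  h i - (K * K + K) / m.+1%:R <=
  \sum_(0 <= l < (m.+1 * m.+1).+1) l%:R * first_visit p i j l.
Proof.
have m0 : 0 < m.+1%:R :> R by rewrite ltr0n.
rewrite mean_partial; apply: le_trans (_ : \sum_(0 <= l < m.+1)
    (surv l i - surv (m.+1 * m.+1) i) <= _); last first.
  rewrite [leRHS](@big_cat_nat _ _ _ m.+1)//=; last by rewrite leq_pmulr.
  rewrite lerDl big_nat_cond; apply: sumr_ge0 => l /andP[/andP[_ lm] _].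
  by rewrite subr_ge0 surv_le// ltnW.
have -> : \sum_(0 <= l < m.+1) (surv l i - surv (m.+1 * m.+1) i) =
   \sum_(0 <= l < m.+1) surv l i - m.+1%:R * surv (m.+1 * m.+1) i.
  by rewrite big_split/= sumr_const_nat subn0 mulNrn [in RHS]mulr_natl.
have h1 : h i - K * K / m.+1%:R <= \sum_(0 <= l < m.+1) surv l i.
  have /andP[_] := rest_bounds m.+1 i; rewrite /rest => hb.
  have : K * surv m.+1 i <= K * (K / m.+1%:R).
    rewrite ler_wpM2l// ler_pdivlMr// mulrC.
    by apply: le_trans (surv_decay m.+1 i); rewrite ler_wpM2r// ler_nat.
  by rewrite lerBlDl -lerBlDr -mulrA; exact: le_trans hb.
have h2 : m.+1%:R * surv (m.+1 * m.+1) i <= K / m.+1%:R.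
  rewrite ler_pdivlMr// mulrAC -natrM.
  by apply: le_trans (surv_decay (m.+1 * m.+1) i); rewrite ler_wpM2r// ler_nat.
by rewrite mulrDl opprD addrA lerB.
Qed.

Let visit_partial_ge m i : 1 - K / m.+1%:R <= \sum_(0 <= l < m.+1) first_visit p i j l.
Proof.
have m0 : 0 < m.+1%:R :> R by rewrite ltr0n.
have : surv m i <= K / m.+1%:R by rewrite ler_pdivlMr// mulrC surv_decay.
by rewrite /surv lerBlDl -lerBlDr.
Qed.

Let visit_partial_le m i : \sum_(0 <= l < m) first_visit p i j l <= 1.
Proof.
case: m => [|m]; first by rewrite big_geq.
by have := surv_ge0 m i; rewrite /surv subr_ge0.
Qed.

(** A bounded nonnegative solution of the first-step equations is the mean hitting time. The visit
    probabilities sum to 1, so the infinite term of the definition becomes [+oo * 0 = 0]. *)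
Lemma hitting_time_eq i : hitting_time p i j = (h i)%:E.
Proof.
rewrite /hitting_time.
rewrite (@nneseries_EFin_eq _ (first_visit p i j) 1 K id); last 3 first.
- by move=> m; exact: first_visit_ge0.
- by move=> m; exact: visit_partial_le.
- by move=> m; exact: visit_partial_ge.
rewrite (@nneseries_EFin_eq _ (fun l => l%:R * first_visit p i j l) (h i) (K * K + K)
  (fun m => m.+1 * m.+1)%N); last 3 first.
- by move=> m; rewrite mulr_ge0// first_visit_ge0.
- by move=> m; exact: mean_partial_le.
- by move=> m; exact: mean_partial_ge.
by rewrite -EFinB subrr mule0 adde0.
Qed.

End first_visit_theory.

Section connected_graphs.
Context (R : realType) (n : nat).
Hypothesis n2 : (2 <= n)%N.

Lemma hitting_time_killed (e : rel 'I_n) (k : 'I_n) (y : 'cV[R]_n) i :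
  simple_graph e -> graph_connected e ->
  (forall i, - drift e [set k]%SET y i = 4) ->
  hitting_time (metropolis R e) i k = (killed_time y i)%:E.
Proof.
move=> eg ec yE.
apply: (@hitting_time_eq _ _ _ _ _ _ _ (4 * n%:R ^+ 4)).
- by move=> a b; exact: metropolis_ge0.
- move=> a; have := metropolis_sum eg (fun=> 1 : R) a.
  under eq_bigr do rewrite mulr1.
  move=> ->; rewrite big1 ?mulr0 ?subr0// => b _.
  by rewrite subrr mulr0.
- by move=> a; exact: (killed_time_ge0 eg yE).
- by move=> a; exact: (killed_time_le n2 eg ec yE).
- exact: (killed_time_target eg yE).
- move=> a ak; rewrite metropolis_sum// (killed_timeE yE ak) mulVf//.
  by rewrite addrC subrK.
Qed.

Variables (G : nat -> rel 'I_n).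
Hypotheses (Gg : forall t, (1 <= t)%N -> simple_graph (G t))
  (Gc : forall t, (1 <= t)%N -> graph_connected (G t)).
Let H := max_hitting_time R G.

(** The bound of [killed_time_le] depends only on [n], so the supremum over all times is finite and
    [fine] returns it unchanged. *)
Lemma le_max_hitting_time t k (y : 'cV[R]_n) i : (1 <= t)%N ->
  (forall i, - drift (G t) [set k]%SET y i = 4) -> killed_time y i <= H.
Proof.
move=> t1 yE; rewrite /H /max_hitting_time; set X := [set h | _].
have Xt : X (killed_time y i)%:E.
  by exists t, i, k; rewrite (hitting_time_killed _ (Gg t1) (Gc t1) yE).
have Xub : (ereal_sup X <= (4 * n%:R ^+ 4)%:E)%E.
  apply: ge_ereal_sup => _ [s [a [b [s1 ->]]]].
  have [z zE] := exists_killed_solution R b n2 (Gg s1) (Gc s1).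
  rewrite (hitting_time_killed _ (Gg s1) (Gc s1) zE) lee_fin.
  exact: (killed_time_le n2 (Gg s1) (Gc s1) zE).
have Xlb := ereal_sup_ubound Xt.
have Xfin : ereal_sup X \is a fin_num.
  by rewrite fin_numE; apply/andP; split; apply/eqP => E; move: Xub Xlb; rewrite E.
by rewrite -lee_fin fineK.
Qed.

Lemma max_hitting_time_ge : 4 * (n%:R - 1) <= H.
Proof.
have k : 'I_n := Ordinal (ltnW n2).
have [y yE] := exists_killed_solution R k n2 (Gg (leqnn 1)) (Gc (leqnn 1)).
have [i hi] := killed_time_max_ge (Gg (leqnn 1)) yE.
exact: le_trans hi (le_max_hitting_time i (leqnn 1) yE).
Qed.

Lemma max_hitting_time_gt0 : 0 < H.
Proof.
apply: lt_le_trans max_hitting_time_ge.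
have : 2 <= n%:R :> R by rewrite ler_nat.
by lra.
Qed.

(** The killed solution for one [k] in [S] remains a supersolution when the other sinks of [S] are
    added. It is at most [H + 4n <= 3H], because [H >= 4 (n - 1) >= 2n]. *)
Lemma hitting_energy t S (y : 'cV[R]_n) : (1 <= t)%N -> S != finset.set0 ->
  4 / (3 * H) * sqnorm y <= energy (G t) S y.
Proof.
move=> t1 /set0Pn[k kS].
have [z zE] := exists_killed_solution R k n2 (Gg t1) (Gc t1).
have hH := max_hitting_time_ge; have H0 := max_hitting_time_gt0.
have n2R : 2 <= n%:R :> R by rewrite ler_nat.
apply: (@energy_supersolution R n (G t) S y (fun i => z i 0)).
- exact: (Gg t1).1.
- move=> i; rewrite (killed_solution_gt0 n2 (Gg t1) zE)/=.
  by have := le_max_hitting_time i t1 zE; rewrite /killed_time; lra.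
- move=> i; rewrite -(zE i) /drift inE opprB addrC -sumrN.
  apply: lerD; first by apply: ler_sum => j _; rewrite -mulrN opprB.
  rewrite ler_wpM2r ?(ltW (killed_solution_gt0 n2 (Gg t1) zE i))//.
  by have [->|_] := eqVneq i k; rewrite ?kS.
Qed.

End connected_graphs.

(** * Second moments *)

Section second_moments.
Context d (T : measurableType d) (R : realType) (P : probability T R) (n : nat).
Implicit Types (Psi : 'M[R]_n).

Lemma Rintegral_sum (I : Type) (r : seq I) (F : I -> T -> R) :
  (forall i, P.-integrable [set: T] (EFin \o F i)) ->
  P.-integrable [set: T] (EFin \o (fun x => \sum_(i <- r) F i x)) /\
  \int[P]_x (\sum_(i <- r) F i x) = \sum_(i <- r) \int[P]_x F i x.
Proof.
move=> iF; elim: r => [|i r [ih1 ih2]].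
  have -> : (fun x => \sum_(i <- [::]) F i x) = cst 0.
    by apply/funext => x; rewrite big_nil.
  split; first exact: (integrable0 P).
  by rewrite big_nil /Rintegral /= integral0.
have E : (fun x => \sum_(j <- i :: r) F j x) = (fun x => F i x + \sum_(j <- r) F j x).
  by apply/funext => x; rewrite big_cons.
rewrite E; split; last by rewrite RintegralD// ih2 big_cons.
by have := integrableD measurableT (iF i) ih1.
Qed.

(** This is [E |Psi X|^2]; the matrix records the steps of the window still to be applied. *)
Definition second_moment (X : 'I_n -> T -> R) Psi : R :=
  \sum_i inner P (fun x => \sum_j Psi i j * X j x) (fun x => \sum_j Psi i j * X j x).

Lemma second_moment_le (X : 'I_n -> T -> R) Psi (rho : R) :
  (forall i, square_integrable P (X i)) ->
  (forall y : 'cV[R]_n, sqnorm (Psi *m y) <= rho * sqnorm y) ->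
  second_moment X Psi <= rho * second_moment X 1%:M.
Proof.
move=> sX hPsi.
have sI (Phi : 'M[R]_n) i : square_integrable P (fun x => \sum_j Phi i j * X j x).
  by apply: square_integrable_sum => j _; exact: square_integrable_scale.
have iE (Phi : 'M[R]_n) := Rintegral_sum (index_enum 'I_n)
  (fun i => square_integrableM (sI Phi i) (sI Phi i)).
have sq (Phi : 'M[R]_n) : (fun x => \sum_i (\sum_j Phi i j * X j x) * (\sum_j Phi i j * X j x)) =
    (fun x => sqnorm ((Phi : 'M[R]_n) *m (\col_j X j x))).
  apply/funext => x; apply: eq_bigr => i _; rewrite mxE expr2.
  by congr (_ * _); apply: eq_bigr => j _; rewrite mxE.
have E (Phi : 'M[R]_n) : second_moment X Phi =
    \int[P]_x sqnorm ((Phi : 'M[R]_n) *m (\col_j X j x)).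
  by rewrite /second_moment -(iE Phi).2 sq.
have iI (Phi : 'M[R]_n) : P.-integrable [set: T]
    (EFin \o (fun x => sqnorm ((Phi : 'M[R]_n) *m (\col_j X j x)))).
  by rewrite -sq; exact: (iE Phi).1.
rewrite !E -RintegralZl//; apply: le_Rintegral => //.
- rewrite (_ : _ \o _ = (fun x => (rho%:E * (sqnorm (1%:M *m \col_j X j x))%:E)%E)).
    by apply: integrableZl => //; exact: (iI 1%:M).
  by apply/funext => x.
- by move=> x _; rewrite mul1mx; exact: hPsi.
Qed.

Lemma second_moment_ge0 (X : 'I_n -> T -> R) Psi : 0 <= second_moment X Psi.
Proof.
by apply: sumr_ge0 => i _; apply: Rintegral_ge0 => x _; rewrite -expr2 sqr_ge0.
Qed.

Section driven.
Variables (X N : nat -> 'I_n -> T -> R) (W : nat -> 'M[R]_n) (c : nat -> R)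
  (V : nat -> 'I_n -> R).
Hypothesis sX : forall i, square_integrable P (X 1%N i).
Hypothesis sN : forall t i, (1 <= t)%N -> square_integrable P (N t i).
Hypothesis XS : forall t i x, (1 <= t)%N ->
  X t.+1 i x = \sum_j W t i j * X t j x + c t * N t i x.
Hypothesis XN : forall i t j, (1 <= t)%N -> inner P (X 1%N i) (N t j) = 0.
Hypothesis NN : forall s i t j, (1 <= s)%N -> (1 <= t)%N -> (s != t) || (i != j) ->
  inner P (N s i) (N t j) = 0.
Hypothesis NV : forall t i, (1 <= t)%N -> inner P (N t i) (N t i) = V t i.

Lemma driven_sqint t i : (1 <= t)%N -> square_integrable P (X t i).
Proof.
case: t => // t _; elim: t i => [//|t ih] i.
rewrite (_ : X t.+2 i = fun x => \sum_j W t.+1 i j * X t.+1 j x + c t.+1 * N t.+1 i x).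
  apply: square_integrableD; last by apply: square_integrable_scale; exact: sN.
  by apply: square_integrable_sum => j _; exact: square_integrable_scale.
by apply/funext => x; rewrite XS.
Qed.

(** The state at time [s] combines the initial state with noises of times before [s], all orthogonal
    to the noise of time [t]. *)
Let XNt s i t j : (1 <= s <= t)%N -> inner P (X s i) (N t j) = 0.
Proof.
case: s => // s; elim: s i => [|s ih] i st; first exact: XN.
rewrite (_ : X s.+2 i = fun x => \sum_j W s.+1 i j * X s.+1 j x + c s.+1 * N s.+1 i x);
  last by apply/funext => x; rewrite XS.
have t1 : (1 <= t)%N by lia.
rewrite innerDl; last 3 first.
- by apply: square_integrable_sum => a _; apply: square_integrable_scale; exact: driven_sqint.
- by apply: square_integrable_scale; exact: sN.
- exact: sN.
rewrite inner_suml; last 2 first.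
- by move=> a _; apply: square_integrable_scale; exact: driven_sqint.
- exact: sN.
rewrite innerZl; [|exact: sN|exact: sN].
rewrite NN// ?mulr0 ?addr0; last by apply/orP; left; lia.
apply: big1 => a _; rewrite innerZl; [|exact: driven_sqint|exact: sN].
by rewrite ih ?mulr0//; lia.
Qed.

Lemma second_momentS t Psi : (1 <= t)%N ->
  second_moment (X t.+1) Psi = second_moment (X t) (Psi *m W t)
    + c t ^+ 2 * \sum_j V t j * \sum_i Psi i j ^+ 2.
Proof.
move=> t1.
have -> : c t ^+ 2 * \sum_j V t j * \sum_i Psi i j ^+ 2 =
    \sum_i c t ^+ 2 * \sum_j Psi i j ^+ 2 * V t j.
  rewrite mulr_sumr; under eq_bigr do rewrite mulr_sumr mulr_sumr.
  rewrite exchange_big/=; apply: eq_bigr => i _.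
  by rewrite mulr_sumr; apply: eq_bigr => j _; rewrite [V t j * _]mulrC.
rewrite -big_split/=; apply: eq_bigr => i _.
pose f x := \sum_j (Psi *m W t) i j * X t j x.
pose g x := \sum_j Psi i j * N t j x.
have sf : square_integrable P f.
  by apply: square_integrable_sum => a _; apply: square_integrable_scale; exact: driven_sqint.
have sg : square_integrable P g.
  by apply: square_integrable_sum => a _; apply: square_integrable_scale; exact: sN.
have scg : square_integrable P (fun x => c t * g x) by exact: square_integrable_scale.
have -> : (fun x => \sum_j Psi i j * X t.+1 j x) = fun x => f x + c t * g x.
  apply/funext => x; under eq_bigr do rewrite XS// mulrDr.
  rewrite big_split/=; congr (_ + _); last first.
    by rewrite mulr_sumr; apply: eq_bigr => j _; rewrite mulrCA.
  under eq_bigr do rewrite mulr_sumr.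
  rewrite exchange_big/=; apply: eq_bigr => j _.
  by rewrite mxE mulr_suml; apply: eq_bigr => a _; rewrite mulrA.
have fg : inner P f g = 0.
  rewrite inner_suml//; last by move=> a _; apply: square_integrable_scale; exact: driven_sqint.
  apply: big1 => a _; rewrite innerZl//; last exact: driven_sqint.
  rewrite innerC inner_suml//; last 2 first.
  - by move=> b _; apply: square_integrable_scale; exact: sN.
  - exact: driven_sqint.
  rewrite big1 ?mulr0// => b _; rewrite innerZl; [|exact: sN|exact: driven_sqint].
  by rewrite innerC XNt ?mulr0// t1 leqnn.
have gg : inner P g g = \sum_j Psi i j ^+ 2 * V t j.
  rewrite inner_suml//; last by move=> a _; apply: square_integrable_scale; exact: sN.
  apply: eq_bigr => a _; rewrite innerZl//; last exact: sN.
  rewrite innerC inner_suml//; last 2 first.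
  - by move=> b _; apply: square_integrable_scale; exact: sN.
  - exact: sN.
  rewrite (bigD1 a)//= big1 ?addr0 => [|b ba]; last first.
    rewrite innerZl; [|exact: sN|exact: sN].
    by rewrite NN ?mulr0// ba orbT.
  rewrite innerZl; [|exact: sN|exact: sN].
  by rewrite NV// mulrA -expr2.
have sfg : square_integrable P (fun x => f x + c t * g x) by exact: square_integrableD.
rewrite (innerDl sf scg sfg) (innerC _ f) (innerDl sf scg sf).
rewrite (innerC _ (fun x => c t * g x) (fun x => f x + _)) (innerDl sf scg scg).
rewrite (innerZl _ sg sf) (innerC _ f (fun x => c t * g x)) (innerZl _ sg sf).
rewrite (innerZl _ sg scg) (innerC _ g (fun x => c t * g x)) (innerZl _ sg sg).
by rewrite (innerC _ g f) fg gg; ring.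
Qed.

Hypothesis V0 : forall t i, (1 <= t)%N -> 0 <= V t i.

Variables (e : nat -> rel 'I_n) (S : nat -> {set 'I_n}) (D : nat -> R).
Hypotheses (eg : forall t, (1 <= t)%N -> simple_graph (e t)).
Hypotheses (D01 : forall t, (1 <= t)%N -> 0 <= D t <= 1).
Hypothesis WE : forall t, (1 <= t)%N -> W t = step_mx (e t) (S t) (D t).

(** The last step is peeled off and absorbed into [Psi], which stays nonexpansive; hence the
    induction runs over all such [Psi]. *)
Lemma second_moment_flow s k Psi : (1 <= s)%N ->
  (forall y : 'cV[R]_n, sqnorm (Psi *m y) <= sqnorm y) ->
  second_moment (X (s + k)%N) Psi <=
    second_moment (X s) (Psi *m flow_mx (fun t => e (s + t)%N) (fun t => S (s + t)%N)
                                        (fun t => D (s + t)%N) k)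
    + \sum_(l < k) c (s + l)%N ^+ 2 * \sum_j V (s + l)%N j.
Proof.
move=> s1; elim: k Psi => [|k ih] Psi hPsi.
  by rewrite addn0 /= mulmx1 big_ord0 addr0.
have sk1 : (1 <= s + k)%N by lia.
rewrite addnS second_momentS// big_ord_recr/= addrA; apply: lerD.
  rewrite WE// mulmxA; apply: ih => y.
  rewrite -mulmxA; apply: le_trans (hPsi _) _.
  exact: sqnorm_step_nonexpansive (eg sk1).1 (D01 sk1).
rewrite ler_wpM2l ?sqr_ge0//; apply: ler_sum => j _.
rewrite ler_piMr ?V0//.
(* A nonexpansive matrix has columns of norm at most 1, so it does not amplify the variance of the
   noise at node [j]. *)
have := hPsi (delta_mx j 0).
have -> : sqnorm (Psi *m delta_mx j 0) = \sum_i Psi i j ^+ 2.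
  by apply: eq_bigr => i _; rewrite -colE mxE.
rewrite [X in _ <= X](_ : _ = 1)// /sqnorm (bigD1 j)//= mxE !eqxx expr1n big1 ?addr0// => i ij.
by rewrite mxE (negbTE ij) expr0n.
Qed.

Lemma second_moment_window s k (rho : R) : (1 <= s)%N ->
  (forall y : 'cV[R]_n, sqnorm (flow_mx (fun t => e (s + t)%N) (fun t => S (s + t)%N)
                                  (fun t => D (s + t)%N) k *m y) <= rho * sqnorm y) ->
  second_moment (X (s + k)%N) 1%:M <= rho * second_moment (X s) 1%:M
    + \sum_(l < k) c (s + l)%N ^+ 2 * \sum_j V (s + l)%N j.
Proof.
move=> s1 hrho; apply: le_trans (second_moment_flow _ s1 _) _.
  by move=> y; rewrite mul1mx.
rewrite mul1mx lerD2r; apply: second_moment_le => // i; exact: driven_sqint.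
Qed.

End driven.
End second_moments.

(** * Functions measurable for a generated sigma-algebra *)

Section generated_sigma.
Context (R : realType) d (Omega : measurableType d) (I : Type) (l : nat).
Variables (D : set I) (X : I -> Omega -> 'rV[R]_l).

Lemma sigma_vectors_measurable E : (forall a, D a -> measurable_vector (X a)) ->
  sigma_vectors D X E -> measurable E.
Proof.
move=> mX; apply: smallest_sub; first exact: sigma_algebra_measurable.
by move=> _ [a Da [k _ [B mB <-]]]; exact: mX.
Qed.

Let GG : set (set Omega) := \bigcup_(i in D) \bigcup_(k in [set: 'I_l])
  preimage_set_system [set: Omega] (fun om => X i om ord0 k)
          (measurable : set (set R)).
Let gen := g_sigma_algebraType GG.

Definition sigma_measurable (f : Omega -> R) :=
  forall B : set R, measurable B -> sigma_vectors D X (f @^-1` B).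

Let gen_measurable (f : gen -> R) : sigma_measurable f <-> measurable_fun [set: gen] f.
Proof.
split=> [h _ B mB|h B mB]; first by rewrite setTI; exact: h.
by have := h measurableT B mB; rewrite setTI.
Qed.

Lemma sigma_measurable_entry a k : D a -> sigma_measurable (fun om => X a om ord0 k).
Proof.
move=> Da B mB; apply: sub_sigma_algebra; exists a => //; exists k => //.
by exists B => //; rewrite setTI.
Qed.

Lemma sigma_measurableM f g : sigma_measurable f -> sigma_measurable g ->
  sigma_measurable (fun om => f om * g om).
Proof.
move=> /gen_measurable mf /gen_measurable mg; apply/gen_measurable.
exact: measurable_funM.
Qed.

Lemma sigma_measurableB f c : sigma_measurable f -> sigma_measurable (fun om => f om - c).
Proof.
move=> /gen_measurable mf; apply/gen_measurable.
exact: measurable_funB.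
Qed.

Lemma sigma_measurable_sum (J : Type) (r : seq J) (Q : pred J) (f : J -> Omega -> R) :
  (forall j, sigma_measurable (f j)) ->
  sigma_measurable (fun om => \sum_(j <- r | Q j) f j om).
Proof.
move=> mf; apply/gen_measurable; rewrite (_ : (fun om => _) =
  (fun om => \sum_(j <- r) (if Q j then f j om else 0))); last first.
  by apply/funext => om; rewrite big_mkcond.
apply: measurable_sum => j /=; case: (Q j); last exact: measurable_cst.
exact/gen_measurable.
Qed.

Lemma sigma_measurable_indic A : sigma_vectors D X A -> sigma_measurable (\1_A).
Proof.
move=> sA; apply/gen_measurable; apply: (@measurable_indic _ gen R setT A).
exact: sA.
Qed.

Lemma sigma_measurable_affine f a c : sigma_measurable f ->
  sigma_measurable (fun om => a + f om * c).
Proof.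
move=> /gen_measurable mf; apply/gen_measurable.
by apply: measurable_funD => //; exact: measurable_funM.
Qed.

Lemma sigma_vectorsI A B : sigma_vectors D X A -> sigma_vectors D X B ->
  sigma_vectors D X (A `&` B).
Proof. exact: (@measurableI _ gen A B). Qed.

Lemma sigma_vectors_le f (Y : Omega -> \bar R) : sigma_measurable f ->
  (forall C : set (\bar R), measurable C -> sigma_vectors D X (Y @^-1` C)) ->
  sigma_vectors D X [set om | ((f om)%:E <= Y om)%E].
Proof.
move=> /gen_measurable mf hY.
have mY : measurable_fun [set: gen] Y by move=> _ C mC; rewrite setTI; exact: hY.
have mf' : measurable_fun [set: gen] (EFin \o f) by exact/measurable_EFinP.
have := @measurable_fun_lee _ gen R setT _ _ mf' mY measurableT [set true].
by move=> /(_ ltac:(by [])); rewrite setTI.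
Qed.

End generated_sigma.

(** * Orthogonality of the noises on events determined by the initial values *)

Section noise_orthogonality.
Context (R : realType) d (Omega : measurableType d) (P : probability Omega R).
Context (n l : nat) (G : nat -> rel 'I_n) (S : nat -> {set 'I_n}).
Variables (sigma sigma' : R) (v1 : 'I_n -> Omega -> 'rV[R]_l).
Variables (w : 'I_n -> nat -> Omega -> 'rV[R]_l)
    (w' : 'I_n -> 'I_n -> nat -> Omega -> 'rV[R]_l).
Hypothesis hw : noise_assumptions P G S sigma sigma' v1 w w'.

Let active := active_noise G S.
Let N (a : noise_index n) (k : 'I_l) (om : Omega) : R := noise w w' a om ord0 k.
Let sd (a : noise_index n) : R := if a is inl _ then sigma else sigma'.

Let N_mean_var a : active a -> entries_mean_var P (noise w w' a) (sd a).
Proof.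
have [_ _ [h1 h2] _ _] := hw.
by case: a => [[i t] [t1 iS]|[[i j] t] [t1 jN]]; [exact: h1|exact: h2].
Qed.

Let N_meas a k : active a -> measurable_fun [set: Omega] (N a k).
Proof. by move=> aa; have [_ + _ _ _] := hw; apply. Qed.

Let N_sigma a k : active a -> sigma_measurable active (noise w w') (N a k).
Proof. by move=> aa; exact: sigma_measurable_entry. Qed.

Let N_mean a k : active a -> \int[P]_x N a k x = 0.
Proof.
by move=> aa; have [+ _] := N_mean_var aa k; rewrite unlock /Rintegral => ->.
Qed.

Let N_sqr a k : active a -> (\int[P]_x (N a k x ^+ 2)%:E = (sd a ^+ 2)%:E)%E.
Proof.
move=> aa; have [m0] := N_mean_var aa k; rewrite /variance unlock m0 /= => <-.
rewrite [in RHS]unlock; apply: eq_integral => x _.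
by congr EFin; rewrite /N /= !fctE /= !subr0 expr2.
Qed.

Let N_sqint a k : active a -> square_integrable P (N a k).
Proof.
move=> aa; have mN := N_meas k aa; split=> //; apply/integrableP; split.
  by apply/measurable_EFinP; exact: measurable_funX.
rewrite (eq_integral (fun x => (N a k x ^+ 2)%:E)) ?N_sqr ?ltry// => x _ /=.
by rewrite ger0_norm ?sqr_ge0.
Qed.

Let N_orth a b k : active a -> active b -> a != b ->
  \int[P]_x (N a k x * N b k x) = 0.
Proof.
move=> aa ab ab'.
have [sa sb] := (N_sqint k aa, N_sqint k ab).
rewrite Rintegral_independentM; first by rewrite N_mean// mul0r.
- exact: N_meas.
- exact: N_meas.
- move=> B C mB mC; have [_ _ _ ind _] := hw.
  have := ind [:: a; b] _ _ (fun c => if c == a then N a k @^-1` B else N b k @^-1` C).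
  rewrite /= inE ab' big_cons big_seq1 eqxx eq_sym (negbTE ab').
  have -> : \bigcap_(c in [set` [:: a; b]])
      (if c == a then N a k @^-1` B else N b k @^-1` C) = N a k @^-1` B `&` N b k @^-1` C.
    apply/seteqP; split=> [x h|x [ha hb] c /=].
      split; first by have := h a; rewrite /= inE eqxx; apply.
      by have := h b; rewrite /= !inE eqxx orbT eq_sym (negbTE ab'); apply.
    by rewrite !inE => /orP[] /eqP ->; rewrite ?eqxx// eq_sym (negbTE ab').
  apply => // c; rewrite !inE => /orP[] /eqP -> //.
    by rewrite eqxx; exact: sigma_measurable_entry.
  by rewrite eq_sym (negbTE ab'); exact: sigma_measurable_entry.
- exact: square_integrable_integrable.
- exact: square_integrable_integrable.
- exact: square_integrableM.
Qed.

Variable A : set Omega.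
Hypothesis sA : sigma_vectors [set: 'I_n] v1 A.

Let v1_meas i : [set: 'I_n] i -> measurable_vector (v1 i).
Proof. by move=> _; have [+ _ _ _ _] := hw; apply. Qed.

Let mA : measurable A. Proof. exact: sigma_vectors_measurable v1_meas sA. Qed.

Let ind_sigma f g : sigma_measurable [set: 'I_n] v1 f ->
  sigma_measurable active (noise w w') g ->
  forall B C, measurable B -> measurable C ->
  (P (f @^-1` B `&` g @^-1` C) = P (f @^-1` B) * P (g @^-1` C))%E.
Proof.
move=> sf sg B C mB mC; have [_ _ _ _ ind] := hw.
by apply: ind; [exact: sf|exact: sg].
Qed.

Let NA a k om : R := \1_A om * N a k om.

Let NA_sqint a k : active a -> square_integrable P (NA a k).
Proof. by move=> aa; apply: square_integrable_indic => //; exact: N_sqint. Qed.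

Let indic_sqr (om : Omega) : \1_A om * \1_A om = \1_A om :> R.
Proof. by rewrite indicE; case: (om \in A); rewrite ?mulr1 ?mulr0. Qed.

(** The indicator of [A] belongs to the initial values and is independent of the product of two
    noises, so restriction to [A] only multiplies the covariance by [P A]. *)
Let NA_inner a b k : active a -> active b ->
  inner P (NA a k) (NA b k) = if a == b then fine (P A) * sd a ^+ 2 else 0.
Proof.
move=> aa ab.
have [sa sb] := (N_sqint k aa, N_sqint k ab).
have iab := square_integrableM sa sb.
have -> : inner P (NA a k) (NA b k) = \int[P]_x (\1_A x * (N a k x * N b k x)).
  apply: eq_Rintegral => x _; rewrite /NA -{3}indic_sqr; ring.
have s1 : square_integrable P (\1_A : Omega -> R).
  apply: (@square_integrable_bounded _ _ _ _ _ 1); first exact: measurable_indic.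
  by move=> x; rewrite indicE; case: (x \in A); rewrite ?normr1 ?normr0.
rewrite Rintegral_independentM.
- have -> : \int[P]_x (\1_A x : R) = fine (P A).
    by rewrite /Rintegral integral_indic// setIT.
  have [<-|ab'] := eqVneq a b; last by rewrite N_orth ?mulr0.
  congr (_ * _); rewrite /Rintegral.
  by under eq_integral do rewrite -expr2; rewrite N_sqr.
- exact: measurable_indic.
- by case: sa => ma _; case: sb => mb _; exact: measurable_funM.
- apply: ind_sigma; first exact: sigma_measurable_indic.
  by apply: sigma_measurableM; exact: N_sigma.
- exact: square_integrable_integrable.
- exact: iab.
- have := square_integrable_indic mA sa.
  move=> /(square_integrableM)/(_ sb).
  by under eq_fun do rewrite -mulrA.
Qed.

Variables (f : Omega -> R) (K : R).
Hypotheses (sf : sigma_measurable [set: 'I_n] v1 f) (fK : forall om, A om -> `|f om| <= K).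

Let fA om := \1_A om * f om.

Let sfA : sigma_measurable [set: 'I_n] v1 fA.
Proof. by apply: sigma_measurableM => //; exact: sigma_measurable_indic. Qed.

Let mfA : measurable_fun [set: Omega] fA.
Proof.
by move=> _ B mB; rewrite setTI; apply: (sigma_vectors_measurable v1_meas); exact: sfA.
Qed.

(** Restriction to an event where [f] is bounded takes the place of a moment assumption on the
    initial values. *)
Lemma initial_sqint : square_integrable P fA.
Proof.
apply: (@square_integrable_bounded _ _ _ _ _ (Num.max 0 K)) => // om.
rewrite /fA indicE normrM; have [/set_mem Aom|_] := boolP (om \in A).
  by rewrite normr1 mul1r le_max fK// orbT.
by rewrite normr0 mul0r le_max lexx.
Qed.

Let initial_NA a k : active a -> inner P fA (NA a k) = 0.
Proof.
move=> aa; have sa := N_sqint k aa.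
have -> : inner P fA (NA a k) = \int[P]_x (fA x * N a k x).
  by apply: eq_Rintegral => x _; rewrite /NA /fA -{3}indic_sqr; ring.
have sfa := initial_sqint.
rewrite Rintegral_independentM; first by rewrite N_mean// mulr0.
- by [].
- exact: N_meas.
- by apply: ind_sigma => //; exact: N_sigma.
- exact: square_integrable_integrable.
- exact: square_integrable_integrable.
- exact: square_integrableM.
Qed.

(* The noise received by node [i] at time [t]: [None] is its measurement, [Some j] the
   observation of its neighbor [j]. *)
Let source t (i : 'I_n) (o : option 'I_n) : noise_index n :=
  if o is Some j then inr (i, j, t) else inl (i, t).
Let received t (i : 'I_n) (o : option 'I_n) : bool :=
  if o is Some j then G t i j else i \in S t.
Let gain t (i : 'I_n) (o : option 'I_n) : R :=
  if o is Some j then weight R (G t) i j else 1.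

Definition nodal_noise t i (k : 'I_l) (om : Omega) : R :=
  (if i \in S t then w i t om ord0 k else 0)
  + \sum_(j | G t i j) weight R (G t) i j * w' i j t om ord0 k.

Let nodal_noiseE t i k om : nodal_noise t i k om =
  \sum_(o | received t i o) gain t i o * N (source t i o) k om.
Proof.
rewrite big_mkcond (bigD1 None)//= mul1r; congr (_ + _).
rewrite big_mkcond [RHS](reindex_omap Some id) /=; last by case.
by apply: eq_big => j; rewrite ?eqxx.
Qed.

Let active_source t i o : (1 <= t)%N -> received t i o -> active (source t i o).
Proof. by move=> t1; case: o => [j|] h; split => //; rewrite inE. Qed.

Let noisy t i k om : R := \1_A om * nodal_noise t i k om.

Let noisyE t i k : noisy t i k =
  fun om => \sum_(o | received t i o) gain t i o * NA (source t i o) k om.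
Proof.
apply/funext => om; rewrite /noisy nodal_noiseE mulr_sumr; apply: eq_bigr => o _.
by rewrite /NA mulrCA.
Qed.

Lemma noisy_sqint t i k : (1 <= t)%N -> square_integrable P (noisy t i k).
Proof.
move=> t1; rewrite noisyE; apply: square_integrable_sum => o ro.
by apply: square_integrable_scale; apply: NA_sqint; exact: active_source.
Qed.

Lemma initial_noisy t i k : (1 <= t)%N -> inner P fA (noisy t i k) = 0.
Proof.
move=> t1; rewrite innerC noisyE inner_suml; last 2 first.
- by move=> o ro; apply: square_integrable_scale; apply: NA_sqint; exact: active_source.
- exact: initial_sqint.
apply: big1 => o ro; rewrite innerZl; last 2 first.
- by apply: NA_sqint; exact: active_source.
- exact: initial_sqint.
by rewrite innerC initial_NA ?mulr0//; exact: active_source.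
Qed.

Let noisy_inner s i t j k : (1 <= s)%N -> (1 <= t)%N ->
  inner P (noisy s i k) (noisy t j k) =
  \sum_(o | received s i o) \sum_(o' | received t j o') gain s i o * (gain t j o' *
    (if source s i o == source t j o' then fine (P A) * sd (source s i o) ^+ 2 else 0)).
Proof.
move=> s1 t1; have sn := noisy_sqint j k t1.
rewrite [X in inner P X _]noisyE inner_suml//; last first.
  by move=> o ro; apply: square_integrable_scale; apply: NA_sqint; exact: active_source.
apply: eq_bigr => o ro; have so := NA_sqint k (active_source s1 ro).
rewrite innerZl// -mulr_sumr; congr (_ * _).
rewrite innerC noisyE inner_suml//; last first.
  by move=> o' ro'; apply: square_integrable_scale; apply: NA_sqint; exact: active_source.
apply: eq_bigr => o' ro'; have so' := NA_sqint k (active_source t1 ro').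
by rewrite innerZl// innerC NA_inner//; exact: active_source.
Qed.

(** A noise index determines its time and its receiving node, so the two combinations have no noise
    in common. *)
Lemma noisy_orth s i t j k : (1 <= s)%N -> (1 <= t)%N -> (s != t) || (i != j) ->
  inner P (noisy s i k) (noisy t j k) = 0.
Proof.
move=> s1 t1 st; rewrite noisy_inner//; apply: big1 => o _; apply: big1 => o' _.
rewrite (_ : (_ == _) = false) ?mulr0//.
apply: contraTF st => /eqP; rewrite negb_or !negbK.
by case: o o' => [a|] [b|] //= [] => [-> _ ->|-> ->]; rewrite !eqxx.
Qed.

Definition noise_variance t i : R :=
  (i \in S t)%:R * sigma ^+ 2 + (\sum_j weight R (G t) i j ^+ 2) * sigma' ^+ 2.

Lemma noisy_var t i k : (1 <= t)%N ->
  inner P (noisy t i k) (noisy t i k) = fine (P A) * noise_variance t i.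
Proof.
move=> t1; rewrite noisy_inner//.
transitivity (\sum_(o | received t i o) fine (P A) * (gain t i o ^+ 2 * sd (source t i o) ^+ 2)).
  apply: eq_bigr => o ro; rewrite (bigD1 o)//= eqxx big1 ?addr0 => [|o' /andP[_ oo]].
    by ring.
  rewrite (_ : (_ == _) = false) ?mulr0//.
  by apply: contraNF oo => /eqP; case: o o' {ro} => [a|] [b|] //= [] ->.
rewrite -mulr_sumr; congr (_ * _).
rewrite big_mkcond (bigD1 None)//= expr1n mul1r; congr (_ + _).
  by case: (i \in S t); rewrite ?mul1r ?mul0r.
rewrite [LHS](reindex_omap Some id) /=; last by case.
rewrite mulr_suml; apply: eq_big => j; first by rewrite eqxx.
rewrite /weight => _; case: (G t i j) => //.
by rewrite expr0n mul0r.
Qed.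

Lemma noise_variance_ge0 t i : 0 <= noise_variance t i.
Proof.
rewrite addr_ge0// mulr_ge0 ?sqr_ge0//; apply: sumr_ge0 => j _; exact: sqr_ge0.
Qed.

(** The squared weights of a node sum to at most 1, as the weights do; thus observations cost
    [sigma'^2] per node, whatever its degree. *)
Lemma noise_variance_sum_le t :
  \sum_i noise_variance t i <= #|S t|%:R * sigma ^+ 2 + n%:R * sigma' ^+ 2.
Proof.
rewrite big_split/= -mulr_suml; apply: lerD.
  have -> : \sum_(i < n) (i \in S t)%:R = #|S t|%:R :> R.
    rewrite -sum1_card natr_sum [RHS]big_mkcond; apply: eq_bigr => i _.
    by case: (i \in S t).
  by [].
rewrite -mulr_suml ler_wpM2r ?sqr_ge0//.
apply: le_trans (_ : \sum_(i < n) 1 <= _); last by rewrite sumr_const card_ord.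
apply: ler_sum => i _; apply: le_trans (weight_sum_le1 R (G t) i).
apply: ler_sum => j _; rewrite expr2 ler_piMr ?weight_ge0//.
apply: le_trans (weight_sum_le1 R (G t) i); rewrite (bigD1 j)//= lerDl.
by apply: sumr_ge0 => j' _; exact: weight_ge0.
Qed.

End noise_orthogonality.

(** * From second moments on events to the conditional expectation *)

Section conditional_bound.
Context (R : realType) d (Omega : measurableType d) (P : probability Omega R).
Context (n l : nat) (mu : 'rV[R]_l) (G : nat -> rel 'I_n) (S : nat -> {set 'I_n}).
Variables (sigma sigma' : R).
Variables (w : 'I_n -> nat -> Omega -> 'rV[R]_l)
    (w' : 'I_n -> 'I_n -> nat -> Omega -> 'rV[R]_l)
    (v : nat -> 'I_n -> Omega -> 'rV[R]_l).
Hypothesis Gg : forall t, (1 <= t)%N -> simple_graph (G t).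
Hypothesis hw : noise_assumptions P G S sigma sigma' (v 1%N) w w'.
Variables (eps : R).
Hypothesis e01 : 0 < eps < 1.
Hypothesis hv : protocol G S mu (stepsize eps) w w' v.

Lemma deviationE t om :
  deviation mu v t om = \sum_i \sum_k ((v t i om - mu) ord0 k) ^+ 2.
Proof.
apply: eq_bigr => i _; rewrite /norm2 sqr_sqrtr//.
by apply: sumr_ge0 => k _; exact: sqr_ge0.
Qed.

Lemma deviation_ge0 t om : 0 <= deviation mu v t om.
Proof.
by rewrite deviationE; apply: sumr_ge0 => i _; apply: sumr_ge0 => k _; exact: sqr_ge0.
Qed.

Let Delta := @stepsize R eps.

Let D01 t : (1 <= t)%N -> 0 <= Delta t <= 1.
Proof.
move=> t1; rewrite stepsize_ge0 stepsize_le1//.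
by case/andP: e01 => _ /ltW.
Qed.

Lemma error_step t i k om : (1 <= t)%N ->
  (v t.+1 i om - mu) ord0 k =
    \sum_j step_mx (G t) (S t) (Delta t) i j * (v t j om - mu) ord0 k
    + Delta t / 4 * nodal_noise G S w w' t i k om.
Proof.
move=> t1.
pose y : 'cV[R]_n := \col_j (v t j om - mu) ord0 k.
have -> : \sum_j step_mx (G t) (S t) (Delta t) i j * (v t j om - mu) ord0 k =
    (step_mx (G t) (S t) (Delta t) *m y) i 0.
  by rewrite mxE; apply: eq_bigr => j _; rewrite [y _ _]mxE.
rewrite step_mxE /drift /nodal_noise [y i 0]mxE.
under eq_bigr do rewrite [y _ _]mxE.
have -> : \sum_j weight R (G t) i j * ((v t j om - mu) ord0 k - (v t i om - mu) ord0 k) =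
    \sum_(j | G t i j) weight R (G t) i j * (v t j om ord0 k - v t i om ord0 k).
  rewrite [RHS]big_mkcond; apply: eq_bigr => j _; rewrite !mxE /weight.
  by case: ifP => _; ring.
rewrite mxE (hv i om t1) /Delta.
set E := \sum_(j | G t i j) weight R (G t) i j * (_ - _).
set F := \sum_(j | G t i j) weight R (G t) i j * w' i j t om ord0 k.
have EF : (\sum_(j in neighbors (G t) i)
    (maxn (degree (G t) i) (degree (G t) j))%:R^-1 *: (v t j om - v t i om + w' i j t om))
      ord0 k = E + F.
  rewrite summxE /E /F -big_split/=; apply: eq_big => j; first by rewrite inE.
  by rewrite inE => Gij; rewrite !mxE /weight Gij; ring.
case: ifP => iS; rewrite !mxE EF ?mul1r ?mul0r; ring.
Qed.

Lemma deviation_measurable :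
  sigma_measurable [set: 'I_n] (v 1%N) (deviation mu v 1%N).
Proof.
rewrite (_ : deviation mu v 1%N =
  fun om => \sum_i \sum_k (v 1%N i om ord0 k - mu ord0 k) * (v 1%N i om ord0 k - mu ord0 k)).
  apply: sigma_measurable_sum => i; apply: sigma_measurable_sum => k.
  by apply: sigma_measurableM; apply: sigma_measurableB; exact: sigma_measurable_entry.
apply/funext => om; rewrite deviationE; apply: eq_bigr => i _; apply: eq_bigr => k _.
by rewrite !mxE expr2.
Qed.

Definition error_flow s := flow_mx (fun t => G (s + t)%N) (fun t => S (s + t)%N)
  (fun t => stepsize eps (s + t)%N) : nat -> 'M[R]_n.

Section event.
Variables (A : set Omega) (K : R).
Hypothesis sA : sigma_vectors [set: 'I_n] (v 1%N) A.
Hypothesis AK : forall om, A om -> forall i k, `|(v 1%N i om - mu) ord0 k| <= K.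

Let X k t i om : R := \1_A om * (v t i om - mu) ord0 k.
Let N k t i om : R := \1_A om * nodal_noise G S w w' t i k om.

Let mA : measurable A.
Proof. by apply: sigma_vectors_measurable sA => i _; have [+ _ _ _ _] := hw; apply. Qed.

Let entry_sigma i k :
  sigma_measurable [set: 'I_n] (v 1%N) (fun om => (v 1%N i om - mu) ord0 k).
Proof.
rewrite (_ : (fun om => _) = fun om => v 1%N i om ord0 k - mu ord0 k).
  by apply: sigma_measurableB; exact: sigma_measurable_entry.
by apply/funext => om; rewrite !mxE.
Qed.

Let sX k i : square_integrable P (X k 1%N i).
Proof. exact: (initial_sqint hw sA (entry_sigma i k) (fun om Ao => AK Ao i k)). Qed.

Let sN k t i : (1 <= t)%N -> square_integrable P (N k t i).
Proof. exact: (noisy_sqint hw sA). Qed.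

Let XS k t i om : (1 <= t)%N -> X k t.+1 i om =
  \sum_j step_mx (G t) (S t) (Delta t) i j * X k t j om + Delta t / 4 * N k t i om.
Proof.
move=> t1; rewrite /X error_step// mulrDr mulr_sumr; congr (_ + _).
  by apply: eq_bigr => j _; rewrite mulrCA.
by rewrite /N mulrCA.
Qed.

Let XN k i t j : (1 <= t)%N -> inner P (X k 1%N i) (N k t j) = 0.
Proof. exact: (initial_noisy hw sA (entry_sigma i k) (fun om Ao => AK Ao i k)). Qed.

Let NN k s i t j : (1 <= s)%N -> (1 <= t)%N -> (s != t) || (i != j) ->
  inner P (N k s i) (N k t j) = 0.
Proof. exact: (noisy_orth hw sA). Qed.

Let V t i := fine (P A) * noise_variance G S sigma sigma' t i.

Let NV k t i : (1 <= t)%N -> inner P (N k t i) (N k t i) = V t i.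
Proof. exact: (noisy_var hw sA). Qed.

Let V0 t i : (1 <= t)%N -> 0 <= V t i.
Proof. by move=> _; rewrite mulr_ge0 ?noise_variance_ge0 ?fine_ge0. Qed.

Let a t : R := \sum_k second_moment P (X k t) 1%:M.

Let q : R := l%:R * (max_measurements R S * sigma ^+ 2 + n%:R * sigma' ^+ 2) * fine (P A).

Let V_sum t : (1 <= t)%N ->
  \sum_i V t i <= fine (P A) * (max_measurements R S * sigma ^+ 2 + n%:R * sigma' ^+ 2).
Proof.
move=> t1; rewrite -mulr_sumr ler_wpM2l ?fine_ge0//.
apply: le_trans (noise_variance_sum_le _ _ _ _ t) _; rewrite lerD2r ler_wpM2r ?sqr_ge0//.
apply: ub_le_sup; last by exists t.
by exists n%:R => _ [s [_ ->]]; rewrite ler_nat -[leqRHS](card_ord n) max_card.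
Qed.

(** The [l] coordinates evolve separately with the same matrices, and every stepsize of the window
    is bounded by its first one. *)
Lemma error_window s k (rho : R) : (1 <= s)%N ->
  (forall y : 'cV[R]_n, sqnorm (error_flow s k *m y) <= rho * sqnorm y) ->
  a (s + k)%N <= rho * a s + k%:R * (Delta s ^+ 2 / 16 * q).
Proof.
move=> s1 hrho; rewrite /a mulr_sumr.
apply: le_trans (_ : \sum_(c < l) (rho * second_moment P (X c s) 1%:M +
   \sum_(m < k) (Delta (s + m)%N / 4) ^+ 2 * \sum_j V (s + m)%N j) <= _).
  apply: ler_sum => c _.
  apply: (@second_moment_window _ _ _ P n (X c) (N c)
     (fun t => step_mx (G t) (S t) (Delta t)) (fun t => Delta t / 4) V
     (sX c) (@sN c) (@XS c) (@XN c) (@NN c) (@NV c) V0 G S Delta) => //.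
rewrite big_split/= lerD2l sumr_const card_ord -[leLHS]mulr_natl.
have -> : k%:R * (Delta s ^+ 2 / 16 * q) = l%:R * \sum_(m < k) (Delta s / 4) ^+ 2 *
  (fine (P A) * (max_measurements R S * sigma ^+ 2 + n%:R * sigma' ^+ 2)).
  by rewrite sumr_const card_ord -[_ *+ k]mulr_natl /q; field.
rewrite ler_wpM2l//; apply: ler_sum => m _.
have sm1 : (1 <= s + m)%N by rewrite (leq_trans s1)// leq_addr.
have Vm0 : 0 <= \sum_j V (s + m)%N j by apply: sumr_ge0 => j _; exact: V0.
apply: ler_pM => //; [exact: sqr_ge0| |exact: V_sum].
have /andP[Dm0 _] := D01 sm1; have /andP[Ds0 _] := D01 s1.
rewrite ler_sqr ?nnegrE ?divr_ge0// ler_wpM2r// stepsize_le//.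
  by case/andP: e01 => _ /ltW.
by rewrite s1 leq_addr.
Qed.

Lemma error_deviation t : (1 <= t)%N ->
  (\int[P]_(om in A) (deviation mu v t om)%:E = (a t)%:E)%E.
Proof.
move=> t1.
have sXt k i : square_integrable P (X k t i).
  exact: (driven_sqint (sX k) (@sN k) (@XS k)).
have iX k i := square_integrableM (sXt k i) (sXt k i).
rewrite integral_mkcond.
have -> : (fun om => (deviation mu v t om)%:E) \_ A =
    (fun om => (\sum_k \sum_i X k t i om * X k t i om)%:E).
  apply/funext => om; rewrite patchE /X; case: ifPn => oA; last first.
    rewrite big1// => k _; rewrite big1// => i _.
    by rewrite indicE (negbTE oA) mul0r mul0r.
  rewrite deviationE exchange_big/=; congr EFin.
  apply: eq_bigr => k _; apply: eq_bigr => i _.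
  by rewrite indicE oA mul1r expr2.
have iS k := Rintegral_sum (index_enum 'I_n) (iX k).
have [iT eT] := Rintegral_sum (index_enum 'I_l) (fun k => (iS k).1).
rewrite -[LHS]fineK; last exact: integrable_fin_num.
congr EFin; rewrite -/(Rintegral _ _ _) eT; apply: eq_bigr => k _.
rewrite (iS k).2; apply: eq_bigr => i _; apply: eq_Rintegral => om _.
by rewrite (bigD1 i)//= big1 ?addr0 ?mxE ?eqxx ?mul1r// => j ji; rewrite mxE eq_sym (negbTE ji) mul0r.
Qed.

Variables (b : nat) (kappa W : R) (t : nat).
Hypotheses (b0 : (0 < b)%N) (k01 : 0 < kappa <= 1).
Hypothesis contr : forall s, (1 <= s)%N -> forall y : 'cV[R]_n,
  sqnorm (error_flow s b *m y) <= (1 - kappa * Delta (s + b).-1) * sqnorm y.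
Hypothesis kappaW : 32 / W <= kappa * Delta b.
Hypothesis We4 : 4 <= W / eps.
Hypothesis t_large :
  2 * b%:R * (3 * (W / eps) * ln (W / eps)) `^ eps^-1 <= t%:R.

Lemma error_bound : a t <=
  2 * b%:R * q * (10^-1 + kappa^-1) / (t%:R / b%:R) `^ (1 - eps)
  + a 1%N * expR (- (4 * ((t%:R / b%:R) `^ eps - 2) / (W * eps))).
Proof.
have q0 : 0 <= q.
  rewrite mulr_ge0 ?fine_ge0// mulr_ge0//.
  have M0 : 0 <= max_measurements R S.
    apply: le_trans (ub_le_sup _ (_ : [set x | exists t, (1 <= t)%N /\ x = #|S t|%:R] #|S 1%N|%:R)) => //.
      by exists n%:R => _ [s [_ ->]]; rewrite ler_nat -[leqRHS](card_ord n) max_card.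
    by exists 1%N.
  by rewrite addr_ge0 // mulr_ge0 // sqr_ge0.
(* Windows are counted from time 1, hence [t - 1]. *)
apply: (@noisy_contraction_bound R eps b a kappa q W t (t.-1 %/ b) (t.-1 %/ b %/ 2)) => //.
- by move=> s; apply: sumr_ge0 => k _; exact: second_moment_ge0.
- move=> s k s1; rewrite -[a s]mul1r; apply: error_window => // y; rewrite mul1r.
  by apply: flow_nonexpansive => m; [apply: Gg|apply: D01]; rewrite (leq_trans s1)// leq_addr.
- by move=> s s1; apply: error_window => //; exact: contr.
- exact: leq_divM.
- by have := ltn_ceil t.-1 b0; case: (t) => //= t' ?; rewrite -ltnS.
- by rewrite mulnC leq_divM.
- by have := ltn_ceil (t.-1 %/ b) (isT : 0 < 2)%N; rewrite mulnC; nat_lia.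
Qed.

End event.

Variables (b : nat) (kappa W : R) (t : nat).
Hypotheses (b0 : (0 < b)%N) (k01 : 0 < kappa <= 1).
Hypothesis contr : forall s, (1 <= s)%N -> forall y : 'cV[R]_n,
  sqnorm (error_flow s b *m y) <= (1 - kappa * Delta (s + b).-1) * sqnorm y.
Hypothesis kappaW : 32 / W <= kappa * Delta b.
Hypothesis We4 : 4 <= W / eps.
Hypothesis t_large :
  2 * b%:R * (3 * (W / eps) * ln (W / eps)) `^ eps^-1 <= t%:R.

Lemma time_ge6 : 6 <= t%:R :> R.
Proof.
apply: le_trans (horizon_ge6 e01 b0 We4 t_large) _.
by rewrite ler_pdivrMr ?ltr0n// ler_peMr// ler1n.
Qed.

(** A violation with margin [1 / (m + 1)] on the event [Z 1 <= m] is an event [A m] of the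
    conditioning sigma-algebra. Integrating both bounds over it gives [P (A m) / (m + 1) <= 0], and
    the null events [A m] cover all violations. *)
Lemma conditional_error_bound (Y : Omega -> \bar R) :
  is_cond_expectation P (sigma_vectors [set: 'I_n] (v 1%N)) (deviation mu v t) Y ->
  {ae P, forall om, (Y om <=
    (2 * b%:R * (l%:R * (max_measurements R S * sigma ^+ 2 + n%:R * sigma' ^+ 2))
       * (10^-1 + kappa^-1) / (t%:R / b%:R) `^ (1 - eps)
     + deviation mu v 1%N om *
       expR (- (4 * ((t%:R / b%:R) `^ eps - 2) / (W * eps))))%:E)%E}.
Proof.
move=> [Y_meas Y_int].
set q := l%:R * _; set c := 2 * b%:R * q * (10^-1 + kappa^-1) / _; set E := expR _.
have t1 : (1 <= t)%N by rewrite -(ler_nat R); have := time_ge6; lra.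
have M0 : 0 <= max_measurements R S.
  apply: le_trans (ub_le_sup _ (_ : [set x | exists t, (1 <= t)%N /\ x = #|S t|%:R] #|S 1%N|%:R)) => //.
    by exists n%:R => _ [s [_ ->]]; rewrite ler_nat -[leqRHS](card_ord n) max_card.
  by exists 1%N.
have c0 : 0 <= c.
  have k0 : 0 <= 10^-1 + kappa^-1.
    by case/andP: k01 => k0 _; rewrite addr_ge0// invr_ge0 ltW.
  rewrite /c divr_ge0 ?powR_ge0// mulr_ge0// mulr_ge0// mulr_ge0//.
  by rewrite addr_ge0 // mulr_ge0 // sqr_ge0.
pose A m := [set om | deviation mu v 1%N om <= m%:R] `&`
  [set om | ((c + m.+1%:R^-1 + deviation mu v 1%N om * E)%:E <= Y om)%E].
have sA m : sigma_vectors [set: 'I_n] (v 1%N) (A m).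
  apply: sigma_vectorsI; last first.
    by apply: sigma_vectors_le => //; apply: sigma_measurable_affine; exact: deviation_measurable.
  rewrite (_ : mkset _ = deviation mu v 1%N @^-1` `]-oo, m%:R]).
    by apply: deviation_measurable; exact: measurable_itv.
  by apply/seteqP; split => om /=; rewrite in_itv.
have v1m i : [set: 'I_n] i -> measurable_vector (v 1%N i).
  by move=> _; have [+ _ _ _ _] := hw; apply.
have mA m : measurable (A m) by exact: sigma_vectors_measurable v1m (sA m).
have AK m om : A m om -> forall i k, `|(v 1%N i om - mu) ord0 k| <= m%:R + 1.
  move=> [/= dm _] i k; have m0 : 0 <= m%:R :> R by [].
  have : ((v 1%N i om - mu) ord0 k) ^+ 2 <= m%:R.
    apply: le_trans dm; rewrite deviationE (bigD1 i)//= (bigD1 k)//= -addrA lerDl.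
    rewrite addr_ge0//; apply: sumr_ge0 => j _; first exact: sqr_ge0.
    by apply: sumr_ge0 => k' _; exact: sqr_ge0.
  move: (_ ord0 k) => x xm.
  by rewrite -ler_sqr ?nnegrE ?addr_ge0// real_normK ?num_real//; nra.
have PA0 m : P (A m) = 0%E.
  have eb := error_bound (sA m) (AK m) b0 k01 contr kappaW We4 t_large.
  have et := error_deviation (sA m) (AK m) t1.
  have e1 := error_deviation (sA m) (AK m) (leqnn 1).
  move: eb et e1; set at_ := \sum_k _; set a1 := \sum_k _ => eb et e1.
  have PAE : (fine (P (A m)))%:E = P (A m) by rewrite fineK// fin_num_measure.
  set p := fine (P (A m)) in eb PAE.
  have p0 : 0 <= p by rewrite fine_ge0.
  have mY : measurable_fun (A m) Y.
    move=> _ C mC; apply: measurableI => //.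
    exact: sigma_vectors_measurable v1m (Y_meas C mC).
  have md : measurable_fun [set: Omega] (deviation mu v 1%N).
    move=> _ C mC; rewrite setTI; apply: sigma_vectors_measurable v1m _.
    exact: deviation_measurable.
  have low : ((c + m.+1%:R^-1) * p + a1 * E)%:E = 
      (\int[P]_(om in A m) ((c + m.+1%:R^-1 + deviation mu v 1%N om * E)%:E))%E.
    under eq_integral do rewrite EFinD EFinM.
    rewrite ge0_integralD//; last 3 first.
    - by move=> om _; rewrite lee_fin addr_ge0.
    - by move=> om _; rewrite mule_ge0 ?lee_fin ?deviation_ge0 ?expR_ge0.
    - by apply: emeasurable_funM => //; apply/measurable_EFinP; exact: measurable_funTS.
    rewrite integral_cst// ge0_integralZr//; last 3 first.
    - by apply/measurable_EFinP; exact: measurable_funTS.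
    - by move=> om _; rewrite lee_fin deviation_ge0.
    - by rewrite lee_fin expR_ge0.
    by rewrite e1 EFinD !EFinM; congr (_ * _ + _)%E; exact: PAE.
  have up : (\int[P]_(om in A m) ((c + m.+1%:R^-1 + deviation mu v 1%N om * E)%:E)
      <= \int[P]_(om in A m) Y om)%E.
    apply: ge0_le_integral => //.
    - move=> om _; rewrite lee_fin addr_ge0 ?mulr_ge0 ?deviation_ge0 ?expR_ge0//.
      by rewrite addr_ge0.
    - apply/measurable_EFinP; apply: measurable_funD => //.
      by apply: measurable_funM => //; exact: measurable_funTS.
    - by move=> om [].
  move: up; rewrite -low (Y_int _ (sA m)) et lee_fin => up.
  have m1 : 0 < m.+1%:R^-1 :> R by rewrite invr_gt0.
  have cq : 2 * b%:R * (l%:R * (max_measurements R S * sigma ^+ 2 + n%:R * sigma' ^+ 2) * p)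
      * (10^-1 + kappa^-1) / (t%:R / b%:R) `^ (1 - eps) = c * p.
    by rewrite /c /q; ring.
  move: eb; rewrite cq -/E => eb.
  have mp : m.+1%:R^-1 * p <= 0.
    by have := le_trans up eb; rewrite lerD2r mulrDl gerDl.
  have : p = 0 by apply/eqP; rewrite eq_le p0 andbT -(pmulr_rle0 _ m1).
  by rewrite -PAE => ->.
have nA m : P.-negligible (A m) by apply/(negligibleP _ (mA m)); exact: PA0.
suff : P.-negligible (~` [set om | (Y om <= (c + deviation mu v 1%N om * E)%:E)%E]) by [].
apply: negligibleS (negligible_bigcup nA).
move=> om /=; move/negP; rewrite -ltNge => hY.
pose r := c + deviation mu v 1%N om * E; rewrite -/r in hY.
have [x x0 hx] : exists2 x : R, 0 < x & ((r + x)%:E <= Y om)%E.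
  case: (Y om) hY => [y| |]; rewrite ?ltNge ?leNye//.
  - rewrite -ltNge lte_fin => ry; exists (y - r); first by rewrite subr_gt0.
    by rewrite lee_fin addrC subrK.
  - by move=> _; exists 1 => //; rewrite leey.
(* Large enough for both conditions of [A m]: [m] exceeds [Z 1], and [1 / (m + 1)] is below the
   margin [x]. *)
pose m := maxn (Num.truncn (deviation mu v 1%N om)).+1 (Num.truncn x^-1).
exists m => //; split => /=.
  apply: ltW; apply: lt_le_trans (truncnS_gt _) _.
  by rewrite ler_nat leq_maxl.
apply: le_trans hx; rewrite lee_fin /r addrAC lerD2l.
rewrite invf_ple ?posrE//; apply: ltW; apply: lt_le_trans (truncnS_gt _) _.
by rewrite ler_nat ltnS leq_maxr.
Qed.
End conditional_bound.

(** * Measurements and cut crossings within a window, and the resulting contraction rates *)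

Section windows.
Context (n : nat) (S : nat -> {set 'I_n}) (T : nat).

(** Take the first measurement time not before [s]. Either it is the initial one, and then [s = 1],
    or its predecessor is before [s] and less than [T] away from it. *)
Lemma measurement_window s : measurement_gaps S T -> (1 <= s)%N ->
  exists2 k, (k < T)%N & S (s + k)%N != finset.set0.
Proof.
move=> [tau [homo tauS tau0 gap]] s1.
have tau_ge k : (k < tau k)%N.
  elim: k => [|k ih]; first by rewrite tau0.
  by apply: leq_ltn_trans ih _; exact: homo.
have exk : exists k, (s <= tau k)%N by exists s; exact/ltnW/tau_ge.
case: (ex_minnP exk) => k sk kmin.
have hk : (tau k - s < T)%N.
  case: k sk kmin => [|k] sk kmin; first by have := gap 0%N; rewrite tau0 in sk *; lia.
  have : (tau k < s)%N by rewrite ltnNge; apply/negP => /kmin; rewrite ltnn.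
  by have := gap k; lia.
exists (tau k - s)%N => //; rewrite subnKC//.
by apply/(tauS (tau k)); [exact: leq_ltn_trans (tau_ge k)|exists k].
Qed.

Lemma union_window (G : nat -> rel 'I_n) (B : nat) s (U : {set 'I_n}) : (0 < B)%N ->
  B_connected G B -> (1 <= s)%N -> U != finset.set0 -> U != [set: 'I_n]%SET ->
  exists2 k, (k < 2 * B)%N &
    exists i j, [/\ i \in U, j \notin U & G (s + k)%N i j].
Proof.
move=> B0 Bc s1 /set0Pn[i iU] UT.
have [j jU] : exists j, j \notin U.
  by move: UT; rewrite -finset.subTset => /subsetPn[j _ jU]; exists j.
(* The ceiling of [(s - 1) / B]: the aligned block from [m B + 1] to [(m + 1) B] starts no earlier
   than [s] and ends before [s + 2 B]. *)
pose m := ((s.-1 + B.-1) %/ B)%N.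
have [i' [j' [iU' jU']]] := connect_cut (Bc m i j) iU jU.
move=> /hasP[t]; rewrite mem_index_iota => /andP[t1 t2] Gt.
have m1 := divn_eq (s.-1 + B.-1) B; have m2 := ltn_pmod (s.-1 + B.-1) B0.
rewrite -/m in m1; rewrite mulSn in t2.
exists (t - s)%N; first by move: (m * B)%N ((_ + _) %% B)%N t1 t2 m1 m2; lia.
exists i', j'; split => //; rewrite subnKC//.
by move: (m * B)%N ((_ + _) %% B)%N t1 t2 m1 m2; lia.
Qed.

End windows.

Section max_degree.
Context (R : realType) (n : nat) (G : nat -> rel 'I_n).

Lemma degree_le_max t i : (1 <= t)%N -> (degree (G t) i)%:R <= max_degree R G.
Proof.
move=> t1; apply: ub_le_sup; last by exists t, i.
by exists n%:R => _ [s [j [_ ->]]]; rewrite ler_nat -[leqRHS](card_ord n) max_card.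
Qed.

Lemma max_degree_ge1 B : (2 <= n)%N -> (0 < B)%N -> B_connected G B -> 1 <= max_degree R G.
Proof.
move=> n2 B0 Bc.
pose i0 : 'I_n := Ordinal (ltnW n2); pose i1 : 'I_n := Ordinal n2.
have [|||k _ [i [j [_ _ Gij]]]] := @union_window n G B 1 [set i0]%SET B0 Bc.
- by [].
- by apply/set0Pn; exists i0; rewrite inE.
- by apply/eqP => /setP/(_ i1); rewrite !inE.
apply: le_trans (degree_le_max (t := (1 + k)%N) i _) => //.
by rewrite ler1n; apply/card_gt0P; exists j; rewrite inE.
Qed.

End max_degree.

Section contraction_rates.
Context (R : realType) (n : nat) (G : nat -> rel 'I_n) (S : nat -> {set 'I_n}) (T : nat).
Hypotheses (n2 : (2 <= n)%N) (Gg : forall t, (1 <= t)%N -> simple_graph (G t)).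
Hypothesis hS : measurement_gaps S T.
Variable eps : R.
Hypothesis e01 : 0 < eps < 1.

Let shift_ge1 s k : (1 <= s)%N -> (1 <= s + k)%N.
Proof. by move=> s1; rewrite (leq_trans s1)// leq_addr. Qed.

Let step01 s k : (1 <= s)%N -> 0 <= stepsize eps (s + k) <= 1.
Proof.
move=> s1; rewrite stepsize_ge0 stepsize_le1 ?shift_ge1//.
by case/andP: e01 => _ /ltW.
Qed.

Let step_end s k b : (1 <= s)%N -> (k < b)%N ->
  stepsize eps (s + b).-1 <= stepsize eps (s + k).
Proof.
move=> s1 kb; apply: stepsize_le; first by case/andP: e01 => _ /ltW.
by apply/andP; split; lia.
Qed.

(** Some step of the window measures; its energy bound [4 / (3 H)] yields the rate [1 / (3 H)], and
    its stepsize is at least the last one of the window. *)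
Lemma connected_contraction s (y : 'cV[R]_n) : (1 <= s)%N ->
  (forall t, (1 <= t)%N -> graph_connected (G t)) ->
  sqnorm (error_flow G S eps s T *m y) <=
    (1 - (3 * max_hitting_time R G)^-1 * stepsize eps (s + T).-1) * sqnorm y.
Proof.
move=> s1 Gc; set H := max_hitting_time R G.
have H0 : 0 < H by exact: max_hitting_time_gt0.
have H4 : 4 <= H.
  apply: le_trans (max_hitting_time_ge R n2 Gg Gc).
  by have : 2 <= n%:R :> R by [rewrite ler_nat]; lra.
have [k kT Sk] := measurement_window hS s1.
have D01 := step01 k s1.
have k0 : 0 <= (3 * H)^-1 by rewrite invr_ge0 mulr_ge0// ltW.
apply: le_trans (_ : (1 - (3 * H)^-1 * stepsize eps (s + k)) * sqnorm y <= _); last first.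
  by rewrite ler_wpM2r ?sqnorm_ge0// lerB// ler_wpM2l// step_end.
apply: (@flow_contraction_at R n (fun t => G (s + t)%N) (fun t => S (s + t)%N)
  (fun t => stepsize eps (s + t))) => //.
- by move=> m; apply: Gg; exact: shift_ge1.
- by move=> m; exact: step01.
- exact: (hitting_energy n2 Gg Gc _ (shift_ge1 k s1) Sk).
rewrite subr_ge0; case/andP: D01 => _ D1.
rewrite -[leRHS]mulr1 ler_pM// ?stepsize_ge0// invf_le1; last by rewrite mulr_gt0.
by lra.
Qed.

(** The set of all nodes is crossed only by a measurement, which occurs within [T] steps; any other
    nonempty set is left by an edge within [2 B] steps. Hence the window is the maximum of the
    two. *)
Lemma B_connected_contraction B s (y : 'cV[R]_n) : (1 <= s)%N -> (0 < B)%N ->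
  B_connected G B ->
  sqnorm (error_flow G S eps s (maxn T (2 * B)) *m y) <=
    (1 - (4 * n%:R ^+ 2 * max_degree R G)^-1 * stepsize eps (s + maxn T (2 * B)).-1) * sqnorm y.
Proof.
move=> s1 B0 Bc; set b := maxn T (2 * B).
apply: (@window_contraction R n (fun t => G (s + t)%N) (fun t => S (s + t)%N)
  (fun t => stepsize eps (s + t))).
- by move=> m; apply: Gg; exact: shift_ge1.
- by move=> m; exact: step01.
- move=> U U0; have [->|UT] := eqVneq U [set: 'I_n]%SET.
    have [k kT /set0Pn[i iS]] := measurement_window hS s1.
    exists k; first by rewrite leq_max kT.
    by apply/orP; right; apply/exists_inP; exists i.
  have [k kB [i [j [iU jU Gij]]]] := union_window B0 Bc s1 U0 UT.
  exists k; first by rewrite leq_max kB orbT.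
  by apply/orP; left; apply/exists_inP; exists i => //; apply/existsP; exists j; rewrite jU.
- exact: ltnW.
- exact: max_degree_ge1 Bc.
- by move=> k i _; apply: degree_le_max; exact: shift_ge1.
- exact: stepsize_ge0.
- by move=> k kb; exact: step_end.
Qed.

End contraction_rates.

Theorem theorem1p2
  (R : realType) (d : measure_display) (Omega : measurableType d)
  (P : probability Omega R) (n l : nat) (hn : (2 <= n)%N)
  (mu : 'rV[R]_l)
  (G : nat -> rel 'I_n) (hG : forall t, (1 <= t)%N -> simple_graph (G t))
  (S : nat -> {set 'I_n}) (T : nat) (hT : (0 < T)%N)
  (hS : measurement_gaps S T)
  (sigma sigma' : R)
  (w : 'I_n -> nat -> Omega -> 'rV[R]_l)
  (w' : 'I_n -> 'I_n -> nat -> Omega -> 'rV[R]_l)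
  (v : nat -> 'I_n -> Omega -> 'rV[R]_l)
  (hw : noise_assumptions P G S sigma sigma' (v 1%N) w w')
  (eps : R) (heps : 0 < eps < 1)
  (hv : protocol G S mu (stepsize eps) w w' v) :
  let Z := deviation mu v in
  let sv1 := sigma_vectors [set: 'I_n] (v 1%N) in
  let M := max_measurements R S in
  ((forall t, (1 <= t)%N -> graph_connected (G t)) ->
   let H := max_hitting_time R G in
   forall t : nat,
     2 * T%:R * (288 * T%:R * H / eps * ln (96 * T%:R * H / eps)) `^ eps^-1
       <= t%:R ->
     forall Y : Omega -> \bar R, is_cond_expectation P sv1 (Z t) Y ->
     {ae P, forall om,
       (Y om <=
         (39 * H * T%:R * l%:R
            * ((M * sigma ^+ 2 + n%:R * T%:R * sigma' ^+ 2)
               / (t%:R / T%:R - 1) `^ (1 - eps)) * ln t%:R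
          + Z 1%N om * expR (- (((t%:R / T%:R - 1) `^ eps - 2)
                                / (24 * H * T%:R * eps))))%:E)%E})
  /\
  (forall B : nat, (0 < B)%N -> B_connected G B ->
   let D := max_degree R G in
   let b : R := (maxn T (2 * B))%:R in
   forall t : nat,
     2 * b * (384 * n%:R ^+ 2 * D * (1 + b) / eps
              * ln (128 * n%:R ^+ 2 * D * (1 + b) / eps)) `^ eps^-1
       <= t%:R ->
     forall Y : Omega -> \bar R, is_cond_expectation P sv1 (Z t) Y ->
     {ae P, forall om,
       (Y om <=
         (51 * n%:R ^+ 2 * D * (1 + b) ^+ 2 * l%:R
            * ((M * sigma ^+ 2 + n%:R * sigma' ^+ 2)
               / (t%:R / b) `^ (1 - eps)) * ln t%:R
          + Z 1%N om * expR (- (((t%:R / b) `^ eps - 2)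
                                / (32 * n%:R ^+ 2 * D * (1 + b) * eps))))%:E)%E}).

Proof.
move=> Z sv1 M.
have T0R : 0 < T%:R :> R by rewrite ltr0n.
have T1 : 1 <= T%:R :> R by rewrite ler1n.
have n2R : 2 <= n%:R :> R by rewrite ler_nat.
have e0 : 0 < eps by case/andP: heps.
have e1 : eps < 1 by case/andP: heps.
have p0 : 0 <= 1 - eps by rewrite subr_ge0 ltW.
have M0 : 0 <= M.
  apply: le_trans (ub_le_sup _ (_ : [set x | exists t, (1 <= t)%N /\ x = #|S t|%:R] #|S 1%N|%:R)) => //.
    by exists n%:R => _ [s [_ ->]]; rewrite ler_nat -[leqRHS](card_ord n) max_card.
  by exists 1%N.
have q0 : 0 <= M * sigma ^+ 2 + n%:R * sigma' ^+ 2.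
  by rewrite addr_ge0 // mulr_ge0 // sqr_ge0.
have step_lb b : (0 < b)%N -> b%:R^-1 <= stepsize eps b.
  move=> b0; rewrite lef_pV2 ?posrE ?powR_gt0 ?ltr0n//.
  by apply: ler1_powR; rewrite ?ler1n// gerBl ltW.
split.
- move=> Gc H t ht Y hY.
  have H4 : 4 <= H.
    by have := max_hitting_time_ge R hn hG Gc; rewrite -/H; lra.
  have H0 : 0 < H by apply: lt_le_trans H4.
  (* Chosen so that [32 / W] is [1 / (3 H)] times [1 / T], a lower bound for [stepsize eps T]. Then
     [3 W] is the 288 of the threshold and [W / 4] the 24 of the exponent. *)
  pose W := 96 * T%:R * H.
  have We : 4 <= W / eps.
    rewrite ler_pdivlMr// /W; have : 1 <= T%:R * H by nra.
    by move=> ?; nra.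
  have k01 : 0 < (3 * H)^-1 <= 1.
    by rewrite invr_gt0 mulr_gt0//= invf_le1 ?mulr_gt0//; lra.
  have kW : 32 / W <= (3 * H)^-1 * stepsize eps T.
    have -> : 32 / W = (3 * H)^-1 * T%:R^-1.
      by rewrite /W; field; rewrite !gt_eqF.
    by rewrite ler_pM2l ?step_lb//; case/andP: k01.
  have ht' : 2 * T%:R * (3 * (W / eps) * ln (W / eps)) `^ eps^-1 <= t%:R.
    apply: le_trans ht; rewrite /W le_eqVlt; apply/orP; left; apply/eqP.
    by congr (_ * (_ * _) `^ _); field; rewrite gt_eqF.
  have u6 := horizon_ge6 heps hT We ht'.
  have t6 := time_ge6 heps hT We ht'.
  have main := conditional_error_bound hG hw heps hv hT k01
    (fun s s1 y => connected_contraction hn hG hS heps y s1 Gc) kW We ht' hY.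
  apply: filterS main => om; move/le_trans; apply; rewrite lee_fin -/M -/(Z 1%N).
  set u := t%:R / T%:R in u6 *.
  have lnt : 1 <= ln t%:R :> R by apply: ln_ge1; lra.
  have up0 : 0 < (u - 1) `^ (1 - eps) by rewrite powR_gt0; lra.
  have uu (p : R) : 0 <= p -> (u - 1) `^ p <= u `^ p.
    by move=> p1; apply: ge0_ler_powR => //; rewrite ?nnegrE; lra.
  apply: lerD; last first.
    rewrite ler_wpM2l ?deviation_ge0// ler_expR lerN2.
    have -> : 4 * (u `^ eps - 2) / (W * eps) = (u `^ eps - 2) / (24 * H * T%:R * eps).
      by rewrite /W; field; rewrite !gt_eqF.
    by rewrite ler_pM2r ?invr_gt0 ?mulr_gt0// lerD2r uu// ltW.
  set q := M * sigma ^+ 2 + n%:R * sigma' ^+ 2 in q0 *.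
  have qq : q <= M * sigma ^+ 2 + n%:R * T%:R * sigma' ^+ 2.
    by rewrite lerD2l mulrAC ler_peMr// mulr_ge0// sqr_ge0.
  set q' := M * _ + n%:R * T%:R * _ in qq *.
  set c := ((u - 1) `^ (1 - eps))^-1.
  have cu : (u `^ (1 - eps))^-1 <= c.
    by rewrite lef_pV2 ?posrE// ?uu//; exact: lt_le_trans up0 (uu _ p0).
  have c0 : 0 < c by rewrite invr_gt0.
  rewrite invrK.
  have s1 : 2 * T%:R * (l%:R * q) * (10^-1 + 3 * H) / u `^ (1 - eps) <=
     2 * T%:R * (l%:R * q') * (10^-1 + 3 * H) * c.
    apply: ler_pM => //; rewrite ?invr_ge0 ?powR_ge0//.
      by rewrite !mulr_ge0//; lra.
    by rewrite ler_wpM2r ?ler_wpM2l ?mulr_ge0//; lra.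
  apply: (le_trans s1).
  have X0 : 0 <= T%:R * l%:R * q' * c.
    by rewrite !mulr_ge0 ?(ltW c0)// (le_trans q0 qq).
  have -> : 2 * T%:R * (l%:R * q') * (10^-1 + 3 * H) * c =
     (T%:R * l%:R * q' * c) * (2 * (10^-1 + 3 * H)) by ring.
  have -> : 39 * H * T%:R * l%:R * (q' * c) * ln t%:R =
     (T%:R * l%:R * q' * c) * (39 * H * ln t%:R) by ring.
  (* What remains is [2 (1/10 + 3 H) <= 39 H ln t], from [H >= 4] and [ln t >= 1]. *)
  by rewrite ler_wpM2l//; nra.
- move=> B B0 Bc D b t ht Y hY.
  set bn := maxn T (2 * B) in b ht *.
  have b0 : (0 < bn)%N by rewrite leq_max hT.
  have b0R : 0 < b by rewrite ltr0n.
  have b1 : 1 <= b by rewrite ler1n.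
  have D1 : 1 <= D by exact: max_degree_ge1 Bc.
  pose g := n%:R ^+ 2 * D.
  have g1 : 1 <= g.
    by rewrite -[1]mulr1 ler_pM// exprn_ege1//; lra.
  have g0 : 0 < g by apply: lt_le_trans g1.
  (* As before with the rate [1 / (4 g)]; [1 / (1 + b)] lies below [1 / b], hence below the stepsize
     at [b]. Now [3 W] gives 384 and [W / 4] gives 32. *)
  pose W := 128 * g * (1 + b).
  have b10 : 0 < 1 + b by lra.
  have W0 : 0 < W by apply: mulr_gt0 => //; exact: mulr_gt0.
  have We : 4 <= W / eps.
    rewrite ler_pdivlMr// /W; have : 1 <= g * (1 + b) by nra.
    by move=> ?; nra.
  have k01 : 0 < (4 * n%:R ^+ 2 * D)^-1 <= 1.
    rewrite -mulrA -/g invr_gt0 mulr_gt0//= invf_le1 ?mulr_gt0//; lra.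
  have kW : 32 / W <= (4 * n%:R ^+ 2 * D)^-1 * stepsize eps bn.
    rewrite -mulrA -/g.
    have -> : 32 / W = (4 * g)^-1 * (1 + b)^-1.
      by rewrite /W; field; rewrite !gt_eqF// addr_gt0.
    rewrite ler_pM2l; last by rewrite invr_gt0 mulr_gt0.
    apply: le_trans (step_lb _ b0).
    by rewrite lef_pV2 ?posrE ?addr_gt0// lerDr.
  have ht' : 2 * b * (3 * (W / eps) * ln (W / eps)) `^ eps^-1 <= t%:R.
    apply: le_trans ht; rewrite /W /g le_eqVlt; apply/orP; left; apply/eqP.
    have -> : 128 * n%:R ^+ 2 * D * (1 + b) / eps = 128 * (n%:R ^+ 2 * D) * (1 + b) / eps.
      by ring.
    by congr (_ * (_ * _) `^ _); ring.
  have u6 := horizon_ge6 heps b0 We ht'.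
  have t6 := time_ge6 heps b0 We ht'.
  have main := conditional_error_bound hG hw heps hv b0 k01
    (fun s s1 y => B_connected_contraction hn hG hS heps y s1 B0 Bc) kW We ht' hY.
  apply: filterS main => om; move/le_trans; apply; rewrite lee_fin -/M -/(Z 1%N) -/b.
  set u := t%:R / b in u6 *.
  have lnt : 1 <= ln t%:R :> R by apply: ln_ge1; lra.
  apply: lerD; last first.
    have -> : 4 * (u `^ eps - 2) / (W * eps) =
        (u `^ eps - 2) / (32 * n%:R ^+ 2 * D * (1 + b) * eps).
      by rewrite /W /g; field; rewrite !gt_eqF// ?addr_gt0//; lra.
    by [].
  set q := M * sigma ^+ 2 + n%:R * sigma' ^+ 2 in q0 *.
  set c := (u `^ (1 - eps))^-1.
  have c0 : 0 <= c by rewrite invr_ge0 powR_ge0.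
  rewrite invrK.
  have X0 : 0 <= l%:R * q * c by rewrite !mulr_ge0.
  have -> : 2 * b * (l%:R * q) * (10^-1 + 4 * n%:R ^+ 2 * D) * c =
     (l%:R * q * c) * (2 * b * (10^-1 + 4 * g)) by rewrite /g; ring.
  have -> : 51 * n%:R ^+ 2 * D * (1 + b) ^+ 2 * l%:R * (q * c) * ln t%:R =
     (l%:R * q * c) * (51 * g * (1 + b) ^+ 2 * ln t%:R) by rewrite /g; ring.
  rewrite ler_wpM2l//.
  have h1 : 2 * b * (10^-1 + 4 * g) <= 51 * g * (1 + b) ^+ 2 by nra.
  apply: (le_trans h1); rewrite ler_peMr//.
  by apply: mulr_ge0; [exact/mulr_ge0/ltW|rewrite sqr_ge0].
Qed.
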